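(* There is a linear-time many-one reduction that transforms every sentence $\Psi$ of two-variable first-order logic with the equality predicate of the form $$\Psi=\forall x\,\gamma(x)\wedge\forall x\forall y\,(x\neq y\to\alpha(x,y))\wedge\bigwedge_{i=1}^m\forall x\exists y\,\bigl(\beta_i(x,y)\wedge x\neq y\bigr),$$ where $\gamma,\alpha$ are quantifier-free and equality-free and each $\beta_i$ is an atomic binary predicate, into a two-variable sentence $\Psi^*$ without the equality predicate such that $\Psi$ is satisfiable if and only if $\Psi^*$ is satisfiable. The reduction increases the number of predicates by at most a constant factor: if $\Psi$ uses $n$ unary and $k$ binary predicates, then $\Psi^*$ uses $O(n+k)$ predicates.
   Context: $\mathrm{FO}^2$ is the fragment of relational first-order logic using only the two variables $x,y$; only unary and binary predicates (and possibly equality) are used, with no constant symbols. Here $m\ge 1$ and $m\le k$, and atoms $R(x,x)$, $R(y,y)$ with $R$ binary are assumed not to occur (they are treated as unary predicates). Every $\mathrm{FO}^2$ sentence with equality can be rewritten into an equi-satisfiable sentence of the displayed form. *)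

(* Defs.v *)
From Corelib Require Import BinNums.
From HB Require Import structures.
From mathcomp Require Import all_boot.

Set Implicit Arguments.
Unset Strict Implicit.
Unset Printing Implicit Defensive.

(** * Syntax of two-variable logic *)

Inductive var : Type := vx | vy.

Definition bool_of_var (v : var) : bool := if v is vx then true else false.
Definition var_of_bool (b : bool) : var := if b then vx else vy.
Lemma bool_of_varK : cancel bool_of_var var_of_bool. Proof. by case. Qed.
HB.instance Definition _ := Countable.copy var (can_type bool_of_varK).
HB.instance Definition _ : isFinite var := CanIsFinite bool_of_varK.

(** The unary and the binary predicate symbols are two disjoint countable
    families, each indexed by [nat]. *)
Inductive fo2 : Type :=
  | FTrue
  | FFalse
  | FEq of var & var
  | FUn of nat & var
  | FBin of nat & var & var
  | FNot of fo2
  | FAnd of fo2 & fo2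
  | FOr of fo2 & fo2
  | FImp of fo2 & fo2
  | FIff of fo2 & fo2
  | FAll of var & fo2
  | FEx of var & fo2.

Fixpoint free (v : var) (f : fo2) : bool :=
  match f with
  | FTrue | FFalse => false
  | FEq a b => (v == a) || (v == b)
  | FUn _ a => v == a
  | FBin _ a b => (v == a) || (v == b)
  | FNot g => free v g
  | FAnd g h | FOr g h | FImp g h | FIff g h => free v g || free v h
  | FAll w g | FEx w g => (v != w) && free v g
  end.

Definition sentence (f : fo2) : bool := ~~ free vx f && ~~ free vy f.

Fixpoint quantifier_free (f : fo2) : bool :=
  match f with
  | FTrue | FFalse | FEq _ _ | FUn _ _ | FBin _ _ _ => true
  | FNot g => quantifier_free g
  | FAnd g h | FOr g h | FImp g h | FIff g h =>
      quantifier_free g && quantifier_free h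
  | FAll _ _ | FEx _ _ => false
  end.

Fixpoint equality_free (f : fo2) : bool :=
  match f with
  | FEq _ _ => false
  | FTrue | FFalse | FUn _ _ | FBin _ _ _ => true
  | FNot g | FAll _ g | FEx _ g => equality_free g
  | FAnd g h | FOr g h | FImp g h | FIff g h =>
      equality_free g && equality_free h
  end.

(** No atom [R(x,x)] or [R(y,y)] with [R] binary. *)
Fixpoint diagonal_free (f : fo2) : bool :=
  match f with
  | FTrue | FFalse | FEq _ _ | FUn _ _ => true
  | FBin _ a b => a != b
  | FNot g | FAll _ g | FEx _ g => diagonal_free g
  | FAnd g h | FOr g h | FImp g h | FIff g h =>
      diagonal_free g && diagonal_free h
  end.

(** Predicate symbols occurring in a formula, with repetitions. *)
Fixpoint unary_occ (f : fo2) : seq nat :=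
  match f with
  | FTrue | FFalse | FEq _ _ | FBin _ _ _ => [::]
  | FUn P _ => [:: P]
  | FNot g | FAll _ g | FEx _ g => unary_occ g
  | FAnd g h | FOr g h | FImp g h | FIff g h => unary_occ g ++ unary_occ h
  end.

Fixpoint binary_occ (f : fo2) : seq nat :=
  match f with
  | FTrue | FFalse | FEq _ _ | FUn _ _ => [::]
  | FBin R _ _ => [:: R]
  | FNot g | FAll _ g | FEx _ g => binary_occ g
  | FAnd g h | FOr g h | FImp g h | FIff g h => binary_occ g ++ binary_occ h
  end.

Definition num_unary (f : fo2) : nat := size (undup (unary_occ f)).
Definition num_binary (f : fo2) : nat := size (undup (binary_occ f)).
Definition num_predicates (f : fo2) : nat := num_unary f + num_binary f.

(** * Semantics *)

Record structure : Type := Structure {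
  dom : Type;
  dom_nonempty : inhabited dom;
  unary_interp : nat -> dom -> Prop;
  binary_interp : nat -> dom -> dom -> Prop
}.

Definition update (D : Type) (e : var -> D) (v : var) (d : D) : var -> D :=
  fun w => if w == v then d else e w.

Fixpoint holds (M : structure) (e : var -> dom M) (f : fo2) : Prop :=
  match f with
  | FTrue => True
  | FFalse => False
  | FEq a b => e a = e b
  | FUn P a => unary_interp P (e a)
  | FBin R a b => binary_interp R (e a) (e b)
  | FNot g => ~ holds e g
  | FAnd g h => holds e g /\ holds e h
  | FOr g h => holds e g \/ holds e h
  | FImp g h => holds e g -> holds e h
  | FIff g h => holds e g <-> holds e h
  | FAll v g => forall d : dom M, holds (update e v d) g
  | FEx v g => exists d : dom M, holds (update e v d) g
  end.

Definition models (M : structure) (f : fo2) : Prop :=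
  forall e : var -> dom M, holds e f.

Definition satisfiable (f : fo2) : Prop := exists M : structure, models M f.

(** * The normal form *)

Fixpoint bigand (s : seq fo2) : fo2 :=
  match s with
  | [::] => FTrue
  | [:: f] => f
  | f :: s' => FAnd f (bigand s')
  end.

Definition neq_xy : fo2 := FNot (FEq vx vy).

Definition normal_form (gamma alpha : fo2) (beta : seq fo2) : fo2 :=
  FAnd (FAll vx gamma)
    (FAnd (FAll vx (FAll vy (FImp neq_xy alpha)))
       (bigand [seq FAll vx (FEx vy (FAnd b neq_xy)) | b <- beta])).

(** [R(x,y)] or [R(y,x)] with [R] binary. *)
Definition binary_atom (f : fo2) : bool :=
  if f is FBin _ a b then a != b else false.

Definition in_normal_form (Psi : fo2) : Prop :=
  exists (gamma alpha : fo2) (beta : seq fo2),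
    [/\ Psi = normal_form gamma alpha beta,
        [&& quantifier_free gamma, equality_free gamma, diagonal_free gamma
          & ~~ free vy gamma],
        [&& quantifier_free alpha, equality_free alpha & diagonal_free alpha],
        all binary_atom beta
      & 1 <= size beta <= num_binary Psi].

(** * Formulas as words

    Polish notation over a fixed finite alphabet; the index of a predicate
    symbol is written in binary, least significant bit first (0 being the empty
    numeral), and is delimited by the variable that follows it. *)

Inductive token : Type :=
  | TTrue | TFalse | TEq | TUn | TBin
  | TNot | TAnd | TOr | TImp | TIff | TAll | TEx
  | TVar of var
  | TBit of bool.

Definition code_of_token (t : token) : 'I_12 + (var + bool) :=
  match t with
  | TTrue => inl (inord 0) | TFalse => inl (inord 1) | TEq => inl (inord 2)
  | TUn => inl (inord 3) | TBin => inl (inord 4) | TNot => inl (inord 5)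
  | TAnd => inl (inord 6) | TOr => inl (inord 7) | TImp => inl (inord 8)
  | TIff => inl (inord 9) | TAll => inl (inord 10) | TEx => inl (inord 11)
  | TVar v => inr (inl v)
  | TBit b => inr (inr b)
  end.

Definition token_of_code (c : 'I_12 + (var + bool)) : token :=
  match c with
  | inl i => nth TTrue [:: TTrue; TFalse; TEq; TUn; TBin; TNot;
                           TAnd; TOr; TImp; TIff; TAll; TEx] i
  | inr (inl v) => TVar v
  | inr (inr b) => TBit b
  end.

Lemma code_of_tokenK : cancel code_of_token token_of_code.
Proof. by case=> //=; rewrite inordK. Qed.
HB.instance Definition _ := Countable.copy token (can_type code_of_tokenK).
HB.instance Definition _ : isFinite token := CanIsFinite code_of_tokenK.

Fixpoint bits_of_pos (p : positive) : seq bool :=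
  match p with
  | xH => [:: true]
  | xO q => false :: bits_of_pos q
  | xI q => true :: bits_of_pos q
  end.

Definition bits_of_nat (n : nat) : seq bool :=
  if bin_of_nat n is Npos p then bits_of_pos p else [::].

Definition numeral (n : nat) : seq token := map TBit (bits_of_nat n).

Fixpoint encode (f : fo2) : seq token :=
  match f with
  | FTrue => [:: TTrue]
  | FFalse => [:: TFalse]
  | FEq a b => [:: TEq; TVar a; TVar b]
  | FUn P a => TUn :: numeral P ++ [:: TVar a]
  | FBin R a b => TBin :: numeral R ++ [:: TVar a; TVar b]
  | FNot g => TNot :: encode g
  | FAnd g h => TAnd :: encode g ++ encode h
  | FOr g h => TOr :: encode g ++ encode h
  | FImp g h => TImp :: encode g ++ encode h
  | FIff g h => TIff :: encode g ++ encode h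
  | FAll v g => TAll :: TVar v :: encode g
  | FEx v g => TEx :: TVar v :: encode g
  end.

(** * Deterministic multitape Turing machines *)

Inductive direction : Type := GoLeft | Stay | GoRight.

(** A two-way infinite tape: the cells left of the head (nearest first), the
    scanned cell, the cells right of the head (nearest first).  [None] is the
    blank, and all cells that are not listed are blank. *)
Record tape (S : Type) : Type := Tape {
  left_cells : seq (option S);
  scanned : option S;
  right_cells : seq (option S)
}.

Definition move_head (S : Type) (d : direction) (t : tape S) : tape S :=
  let: Tape l c r := t in
  match d with
  | GoLeft => Tape (behead l) (head None l) (c :: r)
  | Stay => t
  | GoRight => Tape (c :: l) (head None r) (behead r)
  end.

Definition write_cell (S : Type) (c : option S) (t : tape S) : tape S :=
  Tape (left_cells t) c (right_cells t).

(** [A] is the alphabet of the input and output words; a machine may have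
    further work symbols.  Tape [ord0] is the input tape and tape [ord_max] the
    output tape. *)
Record turing_machine (A : finType) : Type := TuringMachine {
  tm_ntapes : nat;
  tm_state : finType;
  tm_work : finType;
  tm_start : tm_state;
  tm_halting : pred tm_state;
  tm_delta : tm_state ->
    {ffun 'I_tm_ntapes.+1 -> option (A + tm_work)} ->
    tm_state * {ffun 'I_tm_ntapes.+1 -> option (A + tm_work) * direction}
}.

Section Run.
Variables (A : finType) (M : turing_machine A).

Definition tm_symbol : Type := (A + tm_work M)%type.

Record config : Type := Config {
  cfg_state : tm_state M;
  cfg_tapes : 'I_(tm_ntapes M).+1 -> tape tm_symbol
}.

Definition step (c : config) : config :=
  if tm_halting (cfg_state c) then c else
  let: (q, act) :=
    tm_delta (cfg_state c) [ffun i => scanned (cfg_tapes c i)] in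
  Config q
    (fun i => move_head (act i).2 (write_cell (act i).1 (cfg_tapes c i))).

Definition word_cells (w : seq A) : seq (option tm_symbol) :=
  [seq Some (inl a) | a <- w].

Definition input_tape (w : seq A) : tape tm_symbol :=
  Tape [::] (head None (word_cells w)) (behead (word_cells w)).

Definition blank_tape : tape tm_symbol := Tape [::] None [::].

Definition initial (w : seq A) : config :=
  Config (tm_start M) (fun i => if i == ord0 then input_tape w else blank_tape).

(** The tape is blank except for the word [w] on consecutive cells. *)
Definition tape_contains (t : tape tm_symbol) (w : seq A) : Prop :=
  exists a b : nat,
    rev (left_cells t) ++ scanned t :: right_cells t =
    nseq a None ++ word_cells w ++ nseq b None.

Definition outputs_within (w w' : seq A) (n : nat) : Prop :=
  let c := iter n step (initial w) in
  tm_halting (cfg_state c) /\ tape_contains (cfg_tapes c ord_max) w'.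

End Run.

(** [F] is computed in time linear in the length of the word encoding the
    argument, on the arguments satisfying the promise [D].  As [step] is the
    identity on halting configurations, [outputs_within M w w' n] is monotone
    in [n]. *)
Definition linear_time_on (D : fo2 -> Prop) (F : fo2 -> fo2) : Prop :=
  exists (M : turing_machine token) (C : nat),
    forall f : fo2, D f ->
      outputs_within M (encode f) (encode (F f)) (C * size (encode f)).

(* Main.v *)
From Corelib Require Import BinNums.
From HB Require Import structures.
Require Import Defs.
From mathcomp Require Import all_boot.
From mathcomp Require Import zify.
From mathcomp Require Import boolp.

Set Implicit Arguments.
Unset Strict Implicit.
Unset Printing Implicit Defensive.

(** A model of [Psi] is turned into the collection of the searches of its elements for
    their witnesses.  Call an element a king if no other element has its unary type.
    Without equality, elements that are not kings may be duplicated at will, so only the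
    kings matter: each element must see one and the same literal [R(a,c)] whenever it meets
    the king [c].  The search of [a] therefore visits its witnesses one after the
    other in the lexicographic order of their unary types, strictly increasing after a king,
    so that no king is met twice; the requirements met so far are accumulated along the
    search.  A step of a search is an element of the new model, described by unary
    predicates only: three per unary predicate and four per binary predicate of [Psi], and
    three flags.  Pairs of elements that never meet need some admissible literals, which
    two copies of each binary predicate provide.
    Conversely, a tree of searches is unravelled: kings are named by their type, and
    every step to an element that is not a king creates a fresh one.

    The new sentence is a concatenation of fifteen images of the old one, each computed by a
    left-to-right pass with finite control that may copy the numeral it has just read. *)

(** Naming the kings would take a predicate for each of up to $2^n$ unary types, and storing all
    witnesses of an element side by side would take a copy of the unary predicates for each
    $\beta_i$; both exceed $O(n+k)$. Spread over the steps of a search, the witnesses share one copy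
    of the predicates, and the order on types replaces a memory of the kings already visited. One
    excluded type per search suffices: a king avoids itself, and a child of a king avoids its
    parent, whose literals are credited to the child at birth. Only the literals between two kings
    can be fixed from both sides, and a universal condition on pairs of steps makes the sides agree.
    Unrelated pairs need two copies of each binary predicate because one element of a model of the
    new sentence may start the searches of several elements of the unravelled structure: the
    literals between two of these are read off a diagonal pair, where $R(x,x)$ cannot differ from
    its own converse. *)

(** * Multi-pass machines *)

(* [Reg] stands for the numeral that has just been read. *)
Inductive item : Type := Lit of token | Reg.

Definition expand (r : seq bool) (s : seq item) : seq token :=
  flatten [seq if i is Lit t then [:: t] else map TBit r | i <- s].

Section Sweeper.

Variables (K : nat) (Q : finType) (q0 : Q) (nxt : Q -> token -> Q).
Variable out : nat -> Q -> option token -> seq item.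

(** The register [r] belongs to the specification only: the machine finds the numeral again on its
    input tape, just left of the head. *)
Fixpoint sweep (p : nat) (q : Q) (r : seq bool) (w : seq token) : seq token :=
  match w with
  | [::] => expand r (out p q None)
  | TBit b :: w' => sweep p q (rcons r b) w'
  | t :: w' => expand r (out p q (Some t)) ++ sweep p (nxt q t) [::] w'
  end.

Definition sweeps (w : seq token) : seq token :=
  flatten [seq sweep p q0 [::] w | p <- iota 0 K.+1].

Definition width : nat :=
  \max_(p < K.+1) \max_(x : Q * option token) size (out p x.1 x.2).

Lemma size_out p q ot : p < K.+1 -> size (out p q ot) <= width.
Proof.
move=> hp; apply: leq_trans (leq_bigmax (F := fun p : 'I_K.+1 => _) (Ordinal hp)).
exact: (leq_bigmax (F := fun x : Q * option token => size (out p x.1 x.2)) (q, ot)).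
Qed.

(** * Finite control and its runs *)

Inductive mode : Type := Emit | Back | Fwd.

Definition code_of_mode m : option bool :=
  match m with Emit => None | Back => Some true | Fwd => Some false end.
Definition mode_of_code c :=
  match c with None => Emit | Some true => Back | Some false => Fwd end.
Lemma code_of_modeK : cancel code_of_mode mode_of_code. Proof. by case. Qed.
HB.instance Definition _ := Countable.copy mode (can_type code_of_modeK).
HB.instance Definition _ : isFinite mode := CanIsFinite code_of_modeK.

(** To output [Reg], the machine walks back to the start of the numeral and copies it on the way
    forward, so no numeral enters the state. The last index counts the items of the current output
    already written. *)
Definition ctrl : Type :=
  option ('I_K.+1 * option (Q * option (option token * 'I_width.+1 * mode))).

Definition Halt : ctrl := None.
Definition Rewind p : ctrl := Some (inord p, None).
Definition Scan p q : ctrl := Some (inord p, Some (q, None)).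
Definition Work m p q ot k : ctrl := Some (inord p, Some (q, Some (ot, inord k, m))).

Definition is_bit (t : option token) : bool :=
  if t is Some (TBit _) then true else false.

Definition ctrl_step (s : ctrl) (h : option token) :
    ctrl * direction * option token :=
  match s with
  | None => (s, Stay, None)
  | Some (p, None) =>
      if h is Some _ then (s, GoLeft, None)
      else (if p == K :> nat then Halt else Scan p.+1 q0, GoRight, None)
  | Some (p, Some (q, None)) =>
      if is_bit h then (s, GoRight, None) else (Work Emit p q h 0, Stay, None)
  | Some (p, Some (q, Some (ot, k, Emit))) =>
      match drop k (out p q ot) with
      | [::] => if ot is Some t then (Scan p (nxt q t), GoRight, None)
                else (Rewind p, GoLeft, None)
      | Lit t :: _ => (Work Emit p q ot k.+1, Stay, Some t)
      | Reg :: _ => (Work Back p q ot k, GoLeft, None)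
      end
  | Some (p, Some (q, Some (ot, k, Back))) =>
      if is_bit h then (s, GoLeft, None) else (Work Fwd p q ot k, GoRight, None)
  | Some (p, Some (q, Some (ot, k, Fwd))) =>
      if is_bit h then (s, GoRight, h) else (Work Emit p q ot k.+1, Stay, None)
  end.

Record view : Type := View {
  v_ctrl : ctrl;
  v_left : seq (option token);
  v_head : option token;
  v_right : seq (option token);
  v_out : seq token
}.

Definition view_step (v : view) : view :=
  let: (s, d, w) := ctrl_step (v_ctrl v) (v_head v) in
  let o := v_out v ++ (if w is Some t then [:: t] else [::]) in
  let: View _ l h r _ := v in
  match d with
  | GoLeft => View s (behead l) (head None l) (h :: r) o
  | Stay => View s l h r o
  | GoRight => View s (h :: l) (head None r) (behead r) o
  end.

Definition view_reach (n : nat) (v v' : view) : Prop :=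
  exists2 k, k <= n & iter k view_step v = v'.

Lemma view_reach_refl v : view_reach 0 v v.
Proof. by exists 0. Qed.

Lemma view_reach_trans m n v1 v2 v3 :
  view_reach m v1 v2 -> view_reach n v2 v3 -> view_reach (m + n) v1 v3.
Proof.
case=> k hk <- [k' hk' <-]; exists (k' + k); first by rewrite addnC leq_add.
by rewrite iterD.
Qed.

Lemma view_reach_step n v1 v2 :
  view_reach n (view_step v1) v2 -> view_reach n.+1 v1 v2.
Proof. by case=> k hk <-; exists k.+1 => //; rewrite iterSr. Qed.

Lemma view_reach_le m n v v' : m <= n -> view_reach m v v' -> view_reach n v v'.
Proof. by move=> hmn [k hk <-]; exists k => //; apply: leq_trans hmn. Qed.

Definition bits (r : seq bool) : seq (option token) := [seq Some (TBit b) | b <- r].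

Lemma Work_inord m p q ot k :
  Work m (inord p : 'I_K.+1) q ot (inord k : 'I_width.+1) = Work m p q ot k.
Proof. by rewrite /Work !inord_val. Qed.

Lemma Work_inordS m p q ot k : k <= width ->
  Work m (inord p : 'I_K.+1) q ot (inord k : 'I_width.+1).+1 = Work m p q ot k.+1.
Proof. by move=> hk; rewrite /Work inord_val inordK. Qed.

(** The cell [x] is the token or blank just before the numeral, where the walk back turns around. *)
Lemma view_reach_back p q ot k r x l s o : ~~ is_bit x ->
  view_reach (size r).+1
    (View (Work Back p q ot k) (behead (rev (bits r) ++ x :: l))
       (head None (rev (bits r) ++ x :: l)) s o)
    (View (Work Fwd p q ot k) (x :: l) (head None (bits r ++ s))
       (behead (bits r ++ s)) o).
Proof.
move=> hx; elim/last_ind: r s => [|r b IH] s /=.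
  apply: view_reach_step; rewrite /view_step /= (negbTE hx) cats0 Work_inord.
  exact: view_reach_refl.
rewrite size_rcons /bits map_rcons rev_rcons /= cat_rcons.
by apply: view_reach_step; rewrite /view_step /= cats0; apply: (IH (_ :: s)).
Qed.

Lemma view_reach_fwd p q ot k r l h rt o : k <= width -> ~~ is_bit h ->
  view_reach (size r).+1
    (View (Work Fwd p q ot k) l (head None (bits r ++ h :: rt))
       (behead (bits r ++ h :: rt)) o)
    (View (Work Emit p q ot k.+1) (rev (bits r) ++ l) h rt (o ++ map TBit r)).
Proof.
move=> hk hh; elim: r l o => [|b r IH] l o /=.
  apply: view_reach_step; rewrite /view_step /= (negbTE hh) !cats0 Work_inordS //.
  exact: view_reach_refl.
apply: view_reach_step; rewrite /view_step /=.
have := IH (Some (TBit b) :: l) (o ++ [:: TBit b]).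
by rewrite rev_cons cat_rcons -catA.
Qed.

Lemma view_reach_copy p q ot k r x l h rt o : k <= width -> ~~ is_bit x ->
  ~~ is_bit h ->
  view_reach (2 * size r + 2)
    (View (Work Back p q ot k) (behead (rev (bits r) ++ x :: l))
       (head None (rev (bits r) ++ x :: l)) (h :: rt) o)
    (View (Work Emit p q ot k.+1) (rev (bits r) ++ x :: l) h rt (o ++ map TBit r)).
Proof.
move=> hk hx hh; have := view_reach_back p q ot k r l (h :: rt) o hx.
move/view_reach_trans => /(_ _ _ (view_reach_fwd p q ot r (x :: l) rt o hk hh)).
by apply: view_reach_le; lia.
Qed.

Lemma view_reach_emit p q ot k r x l h rt o : p <= K -> ~~ is_bit x ->
  ~~ is_bit h -> k <= size (out p q ot) ->
  view_reach (width * (2 * size r + 3))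
    (View (Work Emit p q ot k) (rev (bits r) ++ x :: l) h rt o)
    (View (Work Emit p q ot (size (out p q ot))) (rev (bits r) ++ x :: l) h rt
       (o ++ expand r (drop k (out p q ot)))).
Proof.
move=> hp hx hh hk; have hw := size_out q ot (hp : p < K.+1).
(* Each remaining item costs at most one step and one round trip over the numeral. *)
apply: (@view_reach_le ((size (out p q ot) - k) * (2 * size r + 3))).
  by rewrite leq_mul2r; lia.
move: {2}(size _ - k) (erefl (size (out p q ot) - k)) => n.
elim: n k o hk => [|n IH] k o hk hn.
  have -> : k = size (out p q ot) by lia.
  by rewrite drop_size cats0 subnn; apply: view_reach_refl.
have ek : drop k (out p q ot) = nth Reg (out p q ot) k :: drop k.+1 (out p q ot).
  by apply: drop_nth; lia.
have hk' : k < width.+1 by lia.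
have {}IH := IH k.+1 _ _ _; rewrite ek.
have -> : (size (out p q ot) - k) * (2 * size r + 3) =
    ((2 * size r + 2) + (size (out p q ot) - k.+1) * (2 * size r + 3)).+1 by nia.
apply: view_reach_step; rewrite /view_step /= !inordK // ek.
case: (nth Reg _ k) => [t|] /=.
  have -> : expand r (Lit t :: drop k.+1 (out p q ot)) =
    [:: t] ++ expand r (drop k.+1 (out p q ot)) by [].
  rewrite catA; apply: (@view_reach_le _ _ _ _ (leq_addl _ _)).
  by apply: IH; lia.
rewrite cats0.
have -> : expand r (Reg :: drop k.+1 (out p q ot)) =
    map TBit r ++ expand r (drop k.+1 (out p q ot)) by [].
rewrite catA.
apply: view_reach_trans (view_reach_copy _ _ _ _ _ _ _ _ _ _) _ => //.
by apply: IH; lia.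
Qed.

Definition cells (w : seq token) : seq (option token) := map Some w ++ [:: None].

(* The potential [size r + size w] pays for the numerals that are copied back. *)
Lemma view_reach_sweep p q r w x l o : p <= K -> ~~ is_bit x ->
  view_reach ((2 * width + 1) * size r + (5 * width + 2) * (size w).+1)
    (View (Scan p q) (rev (bits r) ++ x :: l) (head None (cells w)) (behead (cells w)) o)
    (View (Rewind p) (behead (rev (map Some w) ++ rev (bits r) ++ x :: l))
       (head None (rev (map Some w) ++ rev (bits r) ++ x :: l)) [:: None]
       (o ++ sweep p q r w)).
Proof.
move=> hp; elim: w q r x l o => [|t w IH] q r x l o hx /=.
  apply: (@view_reach_le (width * (2 * size r + 3) + 1).+1); first by nia.
  apply: view_reach_step; rewrite /view_step /= cats0 inordK //.
  apply: view_reach_trans (view_reach_emit (q := q) (ot := None) r l [::] o hp hx (isT : ~~ is_bit None) (leq0n _)) _.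
  have hw := size_out q None (hp : p < K.+1).
  apply: view_reach_step; rewrite /view_step /= !inordK // drop_size cats0 drop0.
  exact: view_reach_refl.
have [[b ->]|ht] : (exists b, t = TBit b) \/ ~~ is_bit (Some t).
  by case: t; try (by right); move=> b; left; exists b.
- apply: (@view_reach_le ((2 * width + 1) * (size r).+1 + (5 * width + 2) * (size w).+1).+1).
    by nia.
  apply: view_reach_step; rewrite /view_step /= cats0.
  have := IH q (rcons r b) x l o hx.
  rewrite size_rcons /bits map_rcons rev_rcons rev_cons cat_rcons.
  exact.
- apply: (@view_reach_le (width * (2 * size r + 3) + ((5 * width + 2) * (size w).+1).+1).+1).
    by nia.
  apply: view_reach_step; rewrite /view_step /ctrl_step [is_bit _](negbTE ht) /= cats0 inordK //.
  have -> : (if t is TBit b then sweep p q (rcons r b) w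
             else expand r (out p q (Some t)) ++ sweep p (nxt q t) [::] w) =
      expand r (out p q (Some t)) ++ sweep p (nxt q t) [::] w by case: t ht.
  apply: view_reach_trans
    (view_reach_emit (q := q) (ot := Some t) r l (cells w) o hp hx ht (leq0n _)) _.
  have hw := size_out q (Some t) (hp : p < K.+1).
  apply: view_reach_step; rewrite /view_step /= !inordK // drop_size cats0 drop0.
  have := IH (nxt q t) [::] (Some t) (rev (bits r) ++ x :: l)
    (o ++ expand r (out p q (Some t))) ht.
  by rewrite muln0 rev_cons cat_rcons -catA.
Qed.

Lemma view_reach_rewind p w s o : p <= K ->
  view_reach (size w).+1
    (View (Rewind p) (behead (rev (map Some w) ++ [:: None]))
       (head None (rev (map Some w) ++ [:: None])) s o)
    (View (if p == K then Halt else Scan p.+1 q0) [:: None]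
       (head None (map Some w ++ s)) (behead (map Some w ++ s)) o).
Proof.
move=> hp; elim/last_ind: w s => [|w t IH] s /=.
  apply: view_reach_step; rewrite /view_step /= cats0 inordK //.
  exact: view_reach_refl.
rewrite size_rcons map_rcons rev_rcons /= cat_rcons.
by apply: view_reach_step; rewrite /view_step /= cats0; apply: (IH (_ :: s)).
Qed.

Lemma view_reach_sweeps w :
  view_reach (K.+1 * ((5 * width + 3) * (size w).+1))
    (View (Scan 0 q0) [:: None] (head None (cells w)) (behead (cells w)) [::])
    (View Halt [:: None] (head None (cells w)) (behead (cells w)) (sweeps w)).
Proof.
have one p o : p <= K -> view_reach ((5 * width + 3) * (size w).+1)
    (View (Scan p q0) [:: None] (head None (cells w)) (behead (cells w)) o)
    (View (if p == K then Halt else Scan p.+1 q0) [:: None]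
       (head None (cells w)) (behead (cells w)) (o ++ sweep p q0 [::] w)).
  move=> hp; have := view_reach_sweep q0 [::] w [::] o hp (isT : ~~ is_bit None).
  move/view_reach_trans => /(_ _ _ (view_reach_rewind w _ _ hp)).
  by apply: view_reach_le; rewrite muln0 add0n; nia.
rewrite /sweeps.
suff gen n p o : p + n = K -> view_reach (n.+1 * ((5 * width + 3) * (size w).+1))
    (View (Scan p q0) [:: None] (head None (cells w)) (behead (cells w)) o)
    (View Halt [:: None] (head None (cells w)) (behead (cells w))
       (o ++ flatten [seq sweep p q0 [::] w | p <- iota p n.+1])).
  exact: (gen K 0 [::]).
elim: n p o => [|n IH] p o hp.
  rewrite addn0 in hp; have := one p o; rewrite hp eqxx leqnn mul1n /= cats0.
  exact.
rewrite mulSn; apply: view_reach_trans (one p o _) _; first by lia.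
have -> : (p == K) = false by lia.
by have := IH p.+1 (o ++ sweep p q0 [::] w); rewrite -catA; apply; lia.
Qed.

(** * Realization by a two-tape Turing machine *)

Definition sweep_symbol : Type := (token + void)%type.

Definition token_of_cell (c : option sweep_symbol) : option token :=
  if c is Some (inl t) then Some t else None.

Definition cell_of_token (c : option token) : option sweep_symbol := omap inl c.

Definition sweep_delta (s : ctrl) (h : {ffun 'I_2 -> option sweep_symbol}) :
    ctrl * {ffun 'I_2 -> option sweep_symbol * direction} :=
  let: (s', d, w) := ctrl_step s (token_of_cell (h ord0)) in
  (s', [ffun i : 'I_2 => if i == ord0 then (h ord0, d)
                  else (cell_of_token w, if w is Some _ then GoRight else Stay)]).

Definition sweep_machine : turing_machine token :=
  @TuringMachine token 1 ctrl void (Scan 0 q0) (pred1 Halt) sweep_delta.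

(** Cells are compared through [nth None] because lists describe a tape only up to trailing blanks:
    the view starts with an explicit blank on the left, the initial tape with an empty list. *)
Definition shows (t : tape sweep_symbol) (l : seq (option token)) (h : option token)
    (r : seq (option token)) : Prop :=
  [/\ nth None (left_cells t) =1 nth None (map cell_of_token l),
      scanned t = cell_of_token h
    & nth None (right_cells t) =1 nth None (map cell_of_token r)].

Definition simulates (c : config sweep_machine) (v : view) : Prop :=
  [/\ cfg_state c = v_ctrl v,
      shows (cfg_tapes c ord0) (v_left v) (v_head v) (v_right v)
    & cfg_tapes c ord_max =
      Tape (rev [seq Some (inl t) | t <- v_out v]) None [::]].

Lemma shows_move d t l h r : shows t l h r ->
  let: View _ l' h' r' _ :=
    match d with
    | GoLeft => View Halt (behead l) (head None l) (h :: r) [::]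
    | Stay => View Halt l h r [::]
    | GoRight => View Halt (h :: l) (head None r) (behead r) [::]
    end in shows (move_head d t) l' h' r'.
Proof.
case: t => tl ts tr [/= hl -> hr]; case: d => //=; split=> //=.
- by move=> i; rewrite nth_behead hl -behead_map nth_behead.
- by rewrite -nth0 hl; case: (l).
- by case=> [|i] //=.
- by case=> [|i] //=.
- by rewrite -nth0 hr; case: (r).
- by move=> i; rewrite nth_behead hr -behead_map nth_behead.
Qed.

Lemma simulates_step c v : simulates c v -> simulates (step c) (view_step v).
Proof.
case: v => s l h r o [/= hs ht ho].
have [e|ne] := eqVneq (cfg_state c) Halt.
  have -> : step c = c by rewrite /step e.
  by move: hs; rewrite e => <-; rewrite /view_step /= cats0; split.
rewrite /step ifN // /view_step /= /sweep_delta ffunE hs.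
have -> : token_of_cell (scanned (cfg_tapes c ord0)) = h by case: ht => _ ->; case: (h).
case: (ctrl_step s h) => [[s' d] w]; have hm := shows_move d ht.
have e0 : write_cell (scanned (cfg_tapes c ord0)) (cfg_tapes c ord0) = cfg_tapes c ord0.
  by case: (cfg_tapes c ord0).
have {}ho : move_head (if w is Some _ then GoRight else Stay)
    (write_cell (cell_of_token w) (cfg_tapes c ord_max)) =
    Tape (rev [seq Some (inl t) | t <- o ++ (if w is Some t then [:: t] else [::])]) None [::].
  by rewrite ho; case: w => [t|] /=; rewrite ?cats0 // map_cat rev_cat.
set act := [ffun i : 'I_2 => _].
have a0 : move_head (act ord0).2 (write_cell (act ord0).1 (cfg_tapes c ord0)) =
    move_head d (cfg_tapes c ord0) by rewrite !ffunE [write_cell _ _]e0.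
have a1 : move_head (act ord_max).2 (write_cell (act ord_max).1 (cfg_tapes c ord_max)) =
    Tape (rev [seq Some (inl t) | t <- o ++ (if w is Some t then [:: t] else [::])]) None [::].
  by rewrite -ho !ffunE.
by case: d hm @act a0 a1 => hm act a0 a1; (split; [ |move: hm; rewrite -a0|exact: a1]).
Qed.

Lemma sweep_machine_outputs w :
  outputs_within sweep_machine w (sweeps w) (K.+1 * ((5 * width + 3) * (size w).+1)).
Proof.
have [k hk ek] := view_reach_sweeps w.
have sim n : simulates (iter n (@step _ sweep_machine) (initial sweep_machine w))
    (iter n view_step
      (View (Scan 0 q0) [:: None] (head None (cells w)) (behead (cells w)) [::])).
  elim: n => [|n IH]; last by rewrite !iterS; apply: simulates_step.
  split=> //=; split=> /=.
  - by case=> [|[]].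
  - by case: w {hk ek}.
  - move=> i; case: w {hk ek} => [|t w] /=; first by rewrite nth_nil.
    rewrite /cells /word_cells map_cat -map_comp /= nth_cat size_map.
    case: ltnP => hi; first by congr nth; apply: eq_map.
    rewrite nth_default ?size_map //.
    by case: (i - _) => [|[]].
have halts n : k <= n ->
    simulates (iter n (@step _ sweep_machine) (initial sweep_machine w))
      (View Halt [:: None] (head None (cells w)) (behead (cells w)) (sweeps w)).
  move=> hn; have := sim (n - k + k); rewrite [iter _ view_step _]iterD ek subnK //.
  suff -> : iter (n - k) view_step
    (View Halt [:: None] (head None (cells w)) (behead (cells w)) (sweeps w)) =
    (View Halt [:: None] (head None (cells w)) (behead (cells w)) (sweeps w)) by [].
  elim: (n - k) => //= j ->; by rewrite /view_step /= cats0.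
case: (halts _ hk) => hs _ ho; split; first by rewrite /= hs eqxx.
exists 0, 1; rewrite ho /= revK /word_cells /=.
by rewrite cats1.
Qed.

End Sweeper.

(** * Predicate names and templates *)

(* [8 <= 8 + j < 16] has a four-bit numeral ending in [true], so the numeral of
   [fresh j P] is a fixed prefix followed by the numeral of [P], even for [P = 0]. *)
Definition fresh (j P : nat) : nat := 8 + j + 16 * P.

Lemma bits_of_nat_odd n : bits_of_nat n.*2.+1 = true :: bits_of_nat n.
Proof.
rewrite /bits_of_nat -{1}(bin_of_natK n); case: (bin_of_nat n) => [|p] //.
have -> : (nat_of_bin (Npos p)).*2.+1 = nat_of_bin (Npos (xI p)) by rewrite /= NatTrec.doubleE.
by rewrite nat_of_binK.
Qed.

Lemma bits_of_nat_even n : 0 < n -> bits_of_nat n.*2 = false :: bits_of_nat n.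
Proof.
rewrite /bits_of_nat -{1 2}(bin_of_natK n); case: (bin_of_nat n) => [|p] // _.
have -> : (nat_of_bin (Npos p)).*2 = nat_of_bin (Npos (xO p)) by rewrite /= NatTrec.doubleE.
by rewrite nat_of_binK.
Qed.

Lemma bits_of_nat_fresh j P : j < 8 ->
  bits_of_nat (fresh j P) = bits_of_nat (8 + j) ++ bits_of_nat P.
Proof.
have -> : fresh j P = 8 + j + P.*2.*2.*2.*2 by rewrite /fresh; lia.
(* Four bits are peeled off; the fourth is always set, which keeps the arguments of
   [bits_of_nat_even] positive. *)
do 8! [case: j => [|j] /=; first
  by rewrite ?(addnS, addSn, addn0, add0n) -?doubleS ?(bits_of_nat_odd, bits_of_nat_even)].
by [].
Qed.

(* In a template the unary index [j < 7] stands for [fresh j P], where [P] is the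
   predicate the template is instantiated with, and [7 + i] for the flag [fresh 7 i]. *)
Definition slot (j P : nat) : nat := if j < 7 then fresh j P else fresh 7 (j - 7).

Fixpoint inst (P : nat) (f : fo2) : fo2 :=
  match f with
  | FTrue => FTrue
  | FFalse => FFalse
  | FEq a b => FEq a b
  | FUn j a => FUn (slot j P) a
  | FBin j a b => FBin (slot j P) a b
  | FNot g => FNot (inst P g)
  | FAnd g h => FAnd (inst P g) (inst P h)
  | FOr g h => FOr (inst P g) (inst P h)
  | FImp g h => FImp (inst P g) (inst P h)
  | FIff g h => FIff (inst P g) (inst P h)
  | FAll v g => FAll v (inst P g)
  | FEx v g => FEx v (inst P g)
  end.

Definition slot_items (j : nat) : seq item :=
  if j < 7 then rcons (map Lit (numeral (8 + j))) Reg else map Lit (numeral (fresh 7 (j - 7))).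

Fixpoint items (f : fo2) : seq item :=
  match f with
  | FTrue => [:: Lit TTrue]
  | FFalse => [:: Lit TFalse]
  | FEq a b => [:: Lit TEq; Lit (TVar a); Lit (TVar b)]
  | FUn j a => Lit TUn :: slot_items j ++ [:: Lit (TVar a)]
  | FBin j a b => Lit TBin :: slot_items j ++ [:: Lit (TVar a); Lit (TVar b)]
  | FNot g => Lit TNot :: items g
  | FAnd g h => Lit TAnd :: items g ++ items h
  | FOr g h => Lit TOr :: items g ++ items h
  | FImp g h => Lit TImp :: items g ++ items h
  | FIff g h => Lit TIff :: items g ++ items h
  | FAll v g => Lit TAll :: Lit (TVar v) :: items g
  | FEx v g => Lit TEx :: Lit (TVar v) :: items g
  end.

Lemma expand_cat r s t : expand r (s ++ t) = expand r s ++ expand r t.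
Proof. by rewrite /expand map_cat flatten_cat. Qed.

Lemma expand_cons r t s : expand r (Lit t :: s) = t :: expand r s.
Proof. by []. Qed.

Lemma expand_lits r w : expand r (map Lit w) = w.
Proof. by elim: w => //= t w IH; rewrite expand_cons IH. Qed.

Lemma expand_slot P j : expand (bits_of_nat P) (slot_items j) = numeral (slot j P).
Proof.
rewrite /slot_items /slot; case: ltnP => hj; last exact: expand_lits.
rewrite -cats1 expand_cat expand_lits /numeral bits_of_nat_fresh; last by lia.
by rewrite map_cat /expand /= cats0.
Qed.

Lemma expand_items P f : expand (bits_of_nat P) (items f) = encode (inst P f).
Proof.
by elim: f => //= *; rewrite ?expand_cons ?expand_cat ?expand_slot; congr (_ :: _);
  try congr (_ :: _); try congr (_ ++ _).
Qed.

(** A template for a binary atom sees the first variable only: without diagonal atoms it determines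
    the second. *)
Fixpoint subst_atoms (tu tb : var -> fo2) (f : fo2) : fo2 :=
  match f with
  | FTrue => FTrue
  | FFalse => FFalse
  | FEq a b => FEq a b
  | FUn P a => inst P (tu a)
  | FBin R a b => inst R (tb a)
  | FNot g => FNot (subst_atoms tu tb g)
  | FAnd g h => FAnd (subst_atoms tu tb g) (subst_atoms tu tb h)
  | FOr g h => FOr (subst_atoms tu tb g) (subst_atoms tu tb h)
  | FImp g h => FImp (subst_atoms tu tb g) (subst_atoms tu tb h)
  | FIff g h => FIff (subst_atoms tu tb g) (subst_atoms tu tb h)
  | FAll v g => FAll v (subst_atoms tu tb g)
  | FEx v g => FEx v (subst_atoms tu tb g)
  end.

(* Whether the predicate is binary, its index, and the first variable. *)
Definition atom : Type := (bool * nat * var)%type.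

Fixpoint atoms (f : fo2) : seq atom :=
  match f with
  | FTrue | FFalse | FEq _ _ => [::]
  | FUn P a => [:: (false, P, a)]
  | FBin R a _ => [:: (true, R, a)]
  | FNot g | FAll _ g | FEx _ g => atoms g
  | FAnd g h | FOr g h | FImp g h | FIff g h => atoms g ++ atoms h
  end.

(* The one shape of fold that yields conjunctions (first component false),
   disjunctions (second component true) and lexicographic comparisons. *)
Definition fold_step (tu tb : var -> fo2 * fo2) (a : atom) (rest : fo2) : fo2 :=
  let: (i, P, v) := a in
  let t := if i then tb v else tu v in FOr (inst P t.1) (FAnd (inst P t.2) rest).

Definition fold_atoms tu tb (base : fo2) (s : seq atom) : fo2 :=
  foldr (fold_step tu tb) base s.

Definition fold_items (t : fo2 * fo2) : seq item :=
  Lit TOr :: items t.1 ++ Lit TAnd :: items t.2.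

(** * The lexer *)

Inductive region : Type := Pre | Gamma | Mid | MidEq | MidVar | Alpha | Beta.

Definition regions := [:: Pre; Gamma; Mid; MidEq; MidVar; Alpha; Beta].
Definition code_of_region (r : region) : 'I_7 :=
  inord match r with
        | Pre => 0 | Gamma => 1 | Mid => 2 | MidEq => 3 | MidVar => 4 | Alpha => 5
        | Beta => 6
        end.
Definition region_of_code (i : 'I_7) : region := nth Pre regions i.
Lemma code_of_regionK : cancel code_of_region region_of_code.
Proof. by case; rewrite /region_of_code inordK. Qed.
HB.instance Definition _ := Countable.copy region (can_type code_of_regionK).
HB.instance Definition _ : isFinite region := CanIsFinite code_of_regionK.

(* [Pending]: a conjunction sign has been read whose output is postponed, since
   it belongs to [gamma] or [alpha] unless a universal quantifier follows. *)
Inductive lexeme : Type := Normal | Pending | AfterUn | AfterBin.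

Definition code_of_lexeme (l : lexeme) : bool * bool :=
  match l with
  | Normal => (false, false) | Pending => (false, true)
  | AfterUn => (true, false) | AfterBin => (true, true)
  end.
Definition lexeme_of_code (c : bool * bool) : lexeme :=
  match c with
  | (false, false) => Normal | (false, true) => Pending
  | (true, false) => AfterUn | (true, true) => AfterBin
  end.
Lemma code_of_lexemeK : cancel code_of_lexeme lexeme_of_code. Proof. by case. Qed.
HB.instance Definition _ := Countable.copy lexeme (can_type code_of_lexemeK).
HB.instance Definition _ : isFinite lexeme := CanIsFinite code_of_lexemeK.

Definition lex_state : finType := (region * lexeme)%type.

(** Since [gamma] and [alpha] are quantifier-free, the next [TAll] tells where each of them ends;
    [alpha] begins after the two variables of the equality. *)
Definition lex_next (q : lex_state) (t : token) : lex_state :=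
  match q, t with
  | (r, AfterUn), _ | (r, AfterBin), _ => (r, Normal)
  | (Pre, _), TVar _ => (Gamma, Normal)
  | (Gamma, _), TAll => (Mid, Normal)
  | (Mid, _), TEq => (MidEq, Normal)
  | (MidEq, _), TVar _ => (MidVar, Normal)
  | (MidVar, _), TVar _ => (Alpha, Normal)
  | (Alpha, _), TAll => (Beta, Normal)
  | (Gamma, _), TAnd => (Gamma, Pending)
  | (Alpha, _), TAnd => (Alpha, Pending)
  | (r, _), TUn => (r, AfterUn)
  | (r, _), TBin => (r, AfterBin)
  | (r, _), _ => (r, Normal)
  end.

Record pass : Type := Pass {
  keeps_connectives : bool;
  active : region -> bool;
  un_items : var -> seq item;
  bin_items : var -> seq item;
  tail : seq token
}.

Definition conn_items (p : pass) (r : region) (t : token) : seq item :=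
  if keeps_connectives p && active p r then [:: Lit t] else [::].

Definition atom_items (p : pass) (r : region) (i : bool) (v : var) : seq item :=
  if active p r then (if i then bin_items p v else un_items p v) else [::].

Definition pass_out (p : pass) (q : lex_state) (t : option token) : seq item :=
  match q, t with
  | _, None => map Lit (tail p)
  | (r, AfterUn), Some (TVar v) => atom_items p r false v
  | (r, AfterBin), Some (TVar v) => atom_items p r true v
  | (r, Pending), Some TAll => [::]
  | (r, l), Some t =>
      (if l is Pending then conn_items p r TAnd else [::]) ++
      (match t with
       | TTrue | TFalse | TNot | TOr | TImp | TIff => conn_items p r t
       | _ => [::]
       end)
  end.

Definition emit_conn p r t : seq token :=
  if keeps_connectives p && active p r then [:: t] else [::].

Definition emit_atom p r (a : atom) : seq token :=
  let: (i, P, v) := a in expand (bits_of_nat P) (atom_items p r i v).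

Fixpoint emit (p : pass) (r : region) (f : fo2) : seq token :=
  match f with
  | FTrue => emit_conn p r TTrue
  | FFalse => emit_conn p r TFalse
  | FEq _ _ => [::]
  | FUn P a => emit_atom p r (false, P, a)
  | FBin R a _ => emit_atom p r (true, R, a)
  | FNot g => emit_conn p r TNot ++ emit p r g
  | FAnd g h => emit_conn p r TAnd ++ emit p r g ++ emit p r h
  | FOr g h => emit_conn p r TOr ++ emit p r g ++ emit p r h
  | FImp g h => emit_conn p r TImp ++ emit p r g ++ emit p r h
  | FIff g h => emit_conn p r TIff ++ emit p r g ++ emit p r h
  | FAll _ g | FEx _ g => emit p r g
  end.

Definition emit_atoms p r (s : seq atom) : seq token := flatten (map (emit_atom p r) s).

Lemma expand_conn r p q t : expand r (conn_items p q t) = emit_conn p q t.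
Proof. by rewrite /conn_items /emit_conn; case: ifP. Qed.

Section Lexing.

Variables (out : nat -> lex_state -> option token -> seq item) (n : nat) (p : pass).
Hypothesis outE : out n = pass_out p.

Local Notation scan := (sweep lex_next out n).

Lemma scan_bits q s r w : scan q r (map TBit s ++ w) = scan q (r ++ s) w.
Proof. by elim: s r => [|b s IH] r /=; rewrite ?cats0 // IH cat_rcons. Qed.

Lemma scan_qf (r : region) (l : lexeme) f w :
  (r = Gamma \/ r = Alpha) -> (l = Normal \/ l = Pending) ->
  quantifier_free f -> equality_free f ->
  scan (r, l) [::] (encode f ++ w) =
  (if l is Pending then emit_conn p r TAnd else [::]) ++ emit p r f ++
  scan (r, Normal) [::] w.
Proof.
move=> hr; elim: f l w => [||a b|P a|R a b|g IH|g IHg h IHh|g IHg h IHh|g IHg h IHh|g IHg h IHh|v g _|v g _] l w hl //= hq he;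
  (try case/andP: hq => hq1 hq2); (try case/andP: he => he1 he2).
- by rewrite outE; case: hr hl => [->|->] [->|->]; rewrite /= ?expand_cat ?expand_conn -?catA.
- by rewrite outE; case: hr hl => [->|->] [->|->]; rewrite /= ?expand_cat ?expand_conn -?catA.
- rewrite -catA outE /=; case: hr hl => [->|->] [->|->];
  by rewrite /= scan_bits /= outE /= ?expand_cat ?expand_conn -?catA.
- rewrite -catA outE /=; case: hr hl => [->|->] [->|->];
  by rewrite /= scan_bits /= outE /= ?expand_cat ?expand_conn -?catA.
- by rewrite outE; case: hr hl IH => [->|->] [->|->] IH;
   rewrite /= IH ?expand_cat ?expand_conn -?catA //=; left.
- by rewrite -catA outE; case: hr hl IHg IHh => [->|->] [->|->] IHg IHh;
   rewrite /= IHg ?IHh ?expand_cat ?expand_conn -?catA //=; (try by left); right.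
- by rewrite -catA outE; case: hr hl IHg IHh => [->|->] [->|->] IHg IHh;
   rewrite /= IHg ?IHh ?expand_cat ?expand_conn -?catA //=; left.
- by rewrite -catA outE; case: hr hl IHg IHh => [->|->] [->|->] IHg IHh;
   rewrite /= IHg ?IHh ?expand_cat ?expand_conn -?catA //=; left.
- by rewrite -catA outE; case: hr hl IHg IHh => [->|->] [->|->] IHg IHh;
   rewrite /= IHg ?IHh ?expand_cat ?expand_conn -?catA //=; left.
Qed.

Lemma scan_beta f w : ~~ (keeps_connectives p && active p Beta) ->
  scan (Beta, Normal) [::] (encode f ++ w) =
  emit_atoms p Beta (atoms f) ++ scan (Beta, Normal) [::] w.
Proof.
move=> /negbTE hc; elim: f w => [||a b|P a|R a b|g IH|g IHg h IHh|g IHg h IHh|g IHg h IHh|g IHg h IHh|v g IH|v g IH] w //=;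
  rewrite ?outE /= -?catA /conn_items ?hc ?IH ?IHg ?IHh /emit_atoms ?map_cat ?flatten_cat
    ?catA //=.
- by rewrite -catA scan_bits /= outE /= cats0.
- by rewrite -catA scan_bits /= outE /= cats0.
Qed.

Lemma scan_normal_form g a s :
  quantifier_free g -> equality_free g -> quantifier_free a -> equality_free a ->
  0 < size s -> ~~ (keeps_connectives p && active p Mid) ->
  ~~ (keeps_connectives p && active p Beta) ->
  scan (Pre, Normal) [::] (encode (normal_form g a s)) =
  emit p Gamma g ++ emit p Alpha a ++
  emit_atoms p Beta (atoms (bigand [seq FAll vx (FEx vy (FAnd b neq_xy)) | b <- s])) ++
  tail p.
Proof.
move=> qg eg qa ea hs /negbTE hm hc; rewrite /normal_form /=.
(* A single requirement starts with [TAll], several with a [TAnd] that stays pending until [TAll]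
   cancels it; nothing is written before region [Beta]. *)
have hb : forall w, (exists w', w = TAll :: w') \/ (exists w', w = TAnd :: TAll :: w') ->
  scan (Alpha, Normal) [::] w = scan (Beta, Normal) [::] w.
  by move=> w [[w' ->]|[w' ->]]; rewrite /= !outE.
rewrite !outE /= scan_qf //; [|by left..].
rewrite /= !outE /= scan_qf //; [|by right|by left]; rewrite /=.
rewrite !expand_conn /emit_conn hm /= -[encode (bigand _)]cats0 hb.
  by rewrite scan_beta //= outE expand_lits.
case: s hs => [|b [|b' s]] //= _; [left|right]; by eexists.
Qed.

End Lexing.

(** * Substitution passes and fold passes *)

Definition in_gamma (r : region) : bool := if r is Gamma then true else false.
Definition in_alpha (r : region) : bool := if r is Alpha then true else false.
Definition in_beta (r : region) : bool := if r is Beta then true else false.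

Definition subst_pass (act : region -> bool) (tu tb : var -> fo2) (w : seq token) : pass :=
  Pass true act (fun v => items (tu v)) (fun v => items (tb v)) w.

Definition fold_pass (act : region -> bool) (tu tb : var -> fo2 * fo2) (w : seq token) :
    pass :=
  Pass false act (fun v => fold_items (tu v)) (fun v => fold_items (tb v)) w.

Lemma emit_subst (act : region -> bool) tu tb w r f : act r ->
  quantifier_free f -> equality_free f ->
  emit (subst_pass act tu tb w) r f = encode (subst_atoms tu tb f).
Proof.
move=> hr; elim: f => [||a b|P a|R a b|g IH|g IHg h IHh|g IHg h IHh|g IHg h IHh|g IHg h IHh|v g _|v g _] //=;
  rewrite /emit_conn /atom_items /= ?hr ?expand_items //.
- by move=> hq he; rewrite IH.
- by move=> /andP[q1 q2] /andP[e1 e2]; rewrite IHg ?IHh.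
- by move=> /andP[q1 q2] /andP[e1 e2]; rewrite IHg ?IHh.
- by move=> /andP[q1 q2] /andP[e1 e2]; rewrite IHg ?IHh.
- by move=> /andP[q1 q2] /andP[e1 e2]; rewrite IHg ?IHh.
Qed.

Lemma emit_inactive p r f : active p r = false -> emit p r f = [::].
Proof.
move=> h; elim: f => //= *; rewrite /emit_conn /atom_items ?h ?andbF //=;
  by repeat match goal with H : _ = [::] |- _ => rewrite H end.
Qed.

Lemma emit_atoms_inactive p r s : active p r = false -> emit_atoms p r s = [::].
Proof. by move=> h; elim: s => //= -[[i P] v] s; rewrite /emit_atoms /= /atom_items h. Qed.

Lemma emit_atoms_cat p r s1 s2 :
  emit_atoms p r (s1 ++ s2) = emit_atoms p r s1 ++ emit_atoms p r s2.
Proof. by rewrite /emit_atoms map_cat flatten_cat. Qed.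

Lemma emit_fold (act : region -> bool) tu tb w r f :
  emit (fold_pass act tu tb w) r f = emit_atoms (fold_pass act tu tb w) r (atoms f).
Proof.
by elim: f => //= *; rewrite /emit_conn /= ?emit_atoms_cat ?/emit_atoms ?/= ?cats0;
  repeat match goal with H : _ = _ |- _ => rewrite H end.
Qed.

(** In Polish notation a fold has no closing symbols: each atom contributes a prefix and the base
    follows the last one, so a single pass can write it. *)
Lemma encode_fold (act : region -> bool) tu tb w r base s : act r ->
  encode (fold_atoms tu tb base s) =
  emit_atoms (fold_pass act tu tb w) r s ++ encode base.
Proof.
move=> h; elim: s => //= -[[i P] v] s IH.
rewrite /emit_atoms /= {1}/atom_items /= h -/(emit_atoms _ _ _).
have -> : (if i then fold_items (tb v) else fold_items (tu v)) =
  fold_items (if i then tb v else tu v) by case: i.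
rewrite /fold_items expand_cons expand_cat expand_cons !expand_items IH.
by rewrite -!catA /= -!catA.
Qed.

(** * The reduction *)

(* An element of a model of the reduced sentence describes a step of an element [a]
   (its source) looking for its witnesses; it records the unary type of [a] ([src]), the
   type of a king which this search may not visit ([excl]), the type of the element [c]
   that is being visited ([tgt]), the literals [R(a,c)] and [R(c,a)] ([fwd], [bwd]) and
   the requirements [R(a,_)], [R(_,a)] that have been met so far ([dfwd], [dbwd]). *)
Definition src v := FUn 0 v.
Definition excl v := FUn 1 v.
Definition tgt v := FUn 2 v.
Definition fwd v := FUn 3 v.
Definition bwd v := FUn 4 v.
Definition dfwd v := FUn 5 v.
Definition dbwd v := FUn 6 v.

Definition flag (i : nat) (v : var) : fo2 := FUn (7 + i) v.
Definition flagged (i : nat) (v : var) : fo2 := FUn (fresh 7 i) v.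

(* Flag 0: no target yet; flags 1 and 2: the source, the target is a king. *)
Definition init_ v := flag 0 v.
Definition ksrc_ v := flag 1 v.
Definition ktgt_ v := flag 2 v.
Definition init v := flagged 0 v.
Definition ksrc v := flagged 1 v.
Definition ktgt v := flagged 2 v.

Definition other (v : var) : var := if v is vx then vy else vx.

Definition skip (v : var) : fo2 * fo2 := (FFalse, FTrue).
Definition conj (f : fo2) (v : var) : fo2 * fo2 := (FFalse, f).
Definition disj (f : fo2) (v : var) : fo2 * fo2 := (f, FTrue).

Definition un_src (v : var) := src vx.
Definition un_cell (v : var) := if v is vx then src vx else tgt vx.
Definition un_llec (v : var) := un_cell (other v).
Definition bin_cell (v : var) := if v is vx then fwd vx else bwd vx.
Definition bin_llec (v : var) := bin_cell (other v).
Definition un_pair (v : var) := src v.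
Definition un_riap (v : var) := src (other v).
Definition bin_pair (v : var) := if v is vx then FBin 0 vx vy else FBin 1 vx vy.
Definition bin_riap (v : var) := bin_pair (other v).

Definition same_src := FIff (src vx) (src vy).
Definition not_reversed :=
  FNot (FAnd (FIff (src vx) (tgt vy)) (FIff (tgt vx) (src vy))).
Definition reversed_bits :=
  FAnd (FIff (fwd vx) (bwd vy)) (FIff (bwd vx) (fwd vy)).
Definition not_excluded := FNot (FIff (excl vx) (tgt vx)).
(** Here [x] is a step and [y] begins the search of its target. The excluded type is the own type of
    a king, and the type of the parent for a child of a king. *)
Definition birth_un :=
  FAnd (FImp (ksrc_ vy) (FIff (excl vy) (src vy)))
    (FOr (init_ vx)
       (FAnd (FIff (src vy) (tgt vx))
          (FImp (FAnd (ksrc_ vx) (FNot (ktgt_ vx))) (FIff (excl vy) (src vx))))).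
(** At birth only requirements witnessed by the parent may be credited to a child; a [bwd] literal
    of the parent's step is a forward literal of the child. *)
Definition birth_bin :=
  FAnd (FImp (dfwd vy) (FAnd (FNot (init_ vx)) (FAnd (FNot (ktgt_ vx)) (bwd vx))))
    (FImp (dbwd vy) (FAnd (FNot (init_ vx)) (FAnd (FNot (ktgt_ vx)) (fwd vx)))).
Definition met (v : var) := conj (if v is vx then dfwd vx else dbwd vx) v.
Definition carry_un :=
  FAnd (FIff (src vx) (src vy)) (FIff (excl vx) (excl vy)).
Definition carry_bin :=
  FAnd (FIff (dfwd vy) (FOr (dfwd vx) (fwd vy)))
    (FIff (dbwd vy) (FOr (dbwd vx) (bwd vy))).
Definition lex_tgt (v : var) : fo2 * fo2 :=
  (FAnd (FNot (tgt vx)) (tgt vy), FIff (tgt vx) (tgt vy)).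
Definition progress :=
  FOr (FAnd (FNot (dfwd vx)) (dfwd vy)) (FAnd (FNot (dbwd vx)) (dbwd vy)).

Definition between_kings : fo2 :=
  FAnd (FAnd (FNot (init vx)) (FAnd (ksrc vx) (ktgt vx)))
    (FAnd (FNot (init vy)) (FAnd (ksrc vy) (ktgt vy))).

Definition forall_xy (f : fo2) : fo2 := FAll vx (FAll vy f).
Definition forall_exists (f : fo2) : fo2 := FAll vx (FEx vy f).

(** The list [s] holds all atoms of the sentence, [sb] those of the $\beta_i$. The conjuncts
    concern, in order, [gamma], [alpha] at a step, [alpha] on unrelated pairs, two kings visiting
    each other, the exclusion, the start of the target's search, and the next step. *)
Definition reduced (g a : fo2) (s sb : seq atom) : fo2 :=
  FAnd (forall_xy (subst_atoms un_src bin_cell g))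
  (FAnd (forall_xy (FOr (init vx)
     (FAnd (subst_atoms un_cell bin_cell a) (subst_atoms un_llec bin_llec a))))
  (FAnd (forall_xy (FOr (fold_atoms (conj same_src) skip (FAnd (ksrc vx) (ksrc vy)) s)
     (FAnd (subst_atoms un_pair bin_pair a) (subst_atoms un_riap bin_riap a))))
  (FAnd (forall_xy (FOr (FNot between_kings)
     (fold_atoms (disj not_reversed) skip
       (fold_atoms skip (conj reversed_bits) FTrue s) s)))
  (FAnd (forall_xy (FOr (FOr (init vx) (FNot (ktgt vx)))
     (fold_atoms (disj not_excluded) skip FFalse s)))
  (FAnd (forall_exists (fold_atoms (conj birth_un) (conj birth_bin)
     (FAnd (init vy) (FOr (init vx) (FIff (ksrc vy) (ktgt vx)))) s))
  (forall_exists (FOr (fold_atoms skip met FTrue sb)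
     (fold_atoms (conj carry_un) (conj carry_bin)
       (FAnd (FAnd (FNot (init vy)) (FIff (ksrc vx) (ksrc vy)))
         (FOr (init vx)
           (fold_atoms lex_tgt skip
             (FAnd (FNot (ktgt vx)) (fold_atoms skip (disj progress) FFalse s)) s))) s)))))))).

Definition reduction (f : fo2) : fo2 :=
  if f is FAnd (FAll _ g) (FAnd (FAll _ (FAll _ (FImp _ a))) b)
  then reduced g a (atoms f) (atoms b) else FTrue.

(** * The fifteen passes *)

Definition all_xy : seq token := [:: TAll; TVar vx; TAll; TVar vy].
Definition all_ex : seq token := [:: TAll; TVar vx; TEx; TVar vy].

(** The tail of each pass writes the tokens between its image and the next one; the initial pass
    writes nothing but such tokens. *)
Definition passes : seq pass :=
  [:: fold_pass pred0 skip skip (TAnd :: all_xy);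
      subst_pass in_gamma un_src bin_cell (TAnd :: all_xy ++ TOr :: encode (init vx) ++ [:: TAnd]);
      subst_pass in_alpha un_cell bin_cell [::];
      subst_pass in_alpha un_llec bin_llec (TAnd :: all_xy ++ [:: TOr]);
      fold_pass predT (conj same_src) skip (encode (FAnd (ksrc vx) (ksrc vy)) ++ [:: TAnd]);
      subst_pass in_alpha un_pair bin_pair [::];
      subst_pass in_alpha un_riap bin_riap
        (TAnd :: all_xy ++ TOr :: encode (FNot between_kings));
      fold_pass predT (disj not_reversed) skip [::];
      fold_pass predT skip (conj reversed_bits)
        (TTrue :: TAnd :: all_xy ++ TOr :: encode (FOr (init vx) (FNot (ktgt vx))));
      fold_pass predT (disj not_excluded) skip (TFalse :: TAnd :: all_ex);
      fold_pass predT (conj birth_un) (conj birth_bin)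
        (encode (FAnd (init vy) (FOr (init vx) (FIff (ksrc vy) (ktgt vx)))) ++
         all_ex ++ [:: TOr]);
      fold_pass in_beta skip met [:: TTrue];
      fold_pass predT (conj carry_un) (conj carry_bin)
        (TAnd :: encode (FAnd (FNot (init vy)) (FIff (ksrc vx) (ksrc vy))) ++
         TOr :: encode (init vx));
      fold_pass predT lex_tgt skip (TAnd :: encode (FNot (ktgt vx)));
      fold_pass predT skip (disj progress) [:: TFalse]].

Definition passes_out (n : nat) : lex_state -> option token -> seq item :=
  pass_out (nth (fold_pass pred0 skip skip [::]) passes n).

Lemma sweeps_reduction f : in_normal_form f ->
  sweeps 14 (Pre, Normal) lex_next passes_out (encode f) = encode (reduction f).
Proof.
move=> [g [a [s [-> /and4P[qg eg _ _] /and3P[qa ea _] _ /andP[hs _]]]]].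
have scanE n : ~~ (keeps_connectives (nth (fold_pass pred0 skip skip [::]) passes n) &&
      active (nth (fold_pass pred0 skip skip [::]) passes n) Mid) ->
    ~~ (keeps_connectives (nth (fold_pass pred0 skip skip [::]) passes n) &&
      active (nth (fold_pass pred0 skip skip [::]) passes n) Beta) -> _ :=
  @scan_normal_form passes_out n (nth (fold_pass pred0 skip skip [::]) passes n) erefl
    g a s qg eg qa ea hs.
have chunks : [seq sweep lex_next passes_out n (Pre, Normal) [::]
      (encode (normal_form g a s)) | n <- iota 0 15] = [seq emit p Gamma g ++ emit p Alpha a ++
      emit_atoms p Beta
        (atoms (bigand [seq FAll vx (FEx vy (FAnd b neq_xy)) | b <- s])) ++
      tail p | p <- passes].
  rewrite -[passes in RHS](mkseq_nth (fold_pass pred0 skip skip [::])) -map_comp.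
  apply/eq_in_map => n; rewrite mem_iota => hn.
  have /(all_nthP (fold_pass pred0 skip skip [::]))/(_ n hn)/andP[h1 h2] :
    all (fun p => ~~ (keeps_connectives p && active p Mid) &&
                  ~~ (keeps_connectives p && active p Beta)) passes by [].
  exact: scanE.
rewrite /sweeps chunks [flatten _]/= {chunks scanE}.
rewrite /reduction /normal_form.
set b := bigand _; set psi := FAnd _ _.
have chunk_gamma tu tb w : emit (subst_pass in_gamma tu tb w) Gamma g ++
    emit (subst_pass in_gamma tu tb w) Alpha a ++
    emit_atoms (subst_pass in_gamma tu tb w) Beta (atoms b) ++ w =
    encode (subst_atoms tu tb g) ++ w.
  by rewrite emit_subst // emit_inactive // emit_atoms_inactive.
have chunk_alpha tu tb w : emit (subst_pass in_alpha tu tb w) Gamma g ++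
    emit (subst_pass in_alpha tu tb w) Alpha a ++
    emit_atoms (subst_pass in_alpha tu tb w) Beta (atoms b) ++ w =
    encode (subst_atoms tu tb a) ++ w.
  by rewrite (emit_inactive (r := Gamma)) // emit_subst // emit_atoms_inactive.
have chunk_beta tu tb w : emit (fold_pass in_beta tu tb w) Gamma g ++
    emit (fold_pass in_beta tu tb w) Alpha a ++
    emit_atoms (fold_pass in_beta tu tb w) Beta (atoms b) ++ w =
    emit_atoms (fold_pass predT tu tb [::]) Pre (atoms b) ++ w.
  by rewrite !emit_inactive.
have chunk_all tu tb w : emit (fold_pass predT tu tb w) Gamma g ++
    emit (fold_pass predT tu tb w) Alpha a ++
    emit_atoms (fold_pass predT tu tb w) Beta (atoms b) ++ w =
    emit_atoms (fold_pass predT tu tb [::]) Pre (atoms psi) ++ w.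
  by rewrite !emit_fold /psi /= !emit_atoms_cat -!catA.
have chunk_none w : emit (fold_pass pred0 skip skip w) Gamma g ++
    emit (fold_pass pred0 skip skip w) Alpha a ++
    emit_atoms (fold_pass pred0 skip skip w) Beta (atoms b) ++ w = w.
  by rewrite !emit_inactive // emit_atoms_inactive.
rewrite !(chunk_gamma, chunk_alpha, chunk_beta, chunk_all, chunk_none).
rewrite /reduced /forall_xy /forall_exists.
have foldE tu tb base s' := @encode_fold predT tu tb [::] Pre base s' isT.
cbn [encode]; rewrite !foldE; cbn [encode].
rewrite !foldE; cbn [encode]; rewrite !foldE /all_xy /all_ex; cbn [encode].
by rewrite -?catA /= -?catA /= -?catA.
Qed.

Lemma outputs_within_le (A : finType) (M : turing_machine A) w w' m n :
  m <= n -> outputs_within M w w' m -> outputs_within M w w' n.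
Proof.
move=> hmn [hh ht]; rewrite /outputs_within -(subnK hmn) iterD.
have fix_ k c : tm_halting (cfg_state c) -> iter k (@step _ M) c = c.
  by move=> hc; elim: k => //= k ->; rewrite /step hc.
by rewrite fix_.
Qed.

Lemma encode_gt0 f : 0 < size (encode f).
Proof. by case: f. Qed.

Lemma reduction_linear_time : linear_time_on in_normal_form reduction.
Proof.
pose W := width 14 passes_out.
(* Fifteen passes; the factor 2 absorbs the extra cell at the end of the word, as no code is
   empty. *)
exists (sweep_machine 14 (Pre, Normal) lex_next passes_out), (15 * ((5 * W + 3) * 2)).
move=> f hf; rewrite -(sweeps_reduction hf).
apply: outputs_within_le (sweep_machine_outputs _ _ _ _ _).
rewrite -!mulnA !leq_mul2l /=; have := encode_gt0 f; lia.
Qed.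

(** * Syntax of the reduced sentence *)

(** Bundles the syntactic conditions on the result with the set of allowed predicates, so that one
    traversal of the templates gives them all. *)
Fixpoint over (Su Sb : pred nat) (f : fo2) : bool :=
  match f with
  | FTrue | FFalse => true
  | FEq _ _ => false
  | FUn P _ => Su P
  | FBin R a b => (a != b) && Sb R
  | FNot g | FAll _ g | FEx _ g => over Su Sb g
  | FAnd g h | FOr g h | FImp g h | FIff g h => over Su Sb g && over Su Sb h
  end.

Lemma overP Su Sb f : over Su Sb f =
  [&& equality_free f, diagonal_free f, all Su (unary_occ f) & all Sb (binary_occ f)].
Proof.
have ac b1 b2 b3 b4 c1 c2 c3 c4 : [&& b1, b2, b3 & b4] && [&& c1, c2, c3 & c4] =
    [&& b1 && c1, b2 && c2, b3 && c3 & b4 && c4].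
  by case: b1 b2 b3 b4 => [] [] [] []; rewrite ?andbF.
elim: f => //= [P a|R a b|g -> h ->|g -> h ->|g -> h ->|g -> h ->];
  by rewrite ?andbT // !all_cat.
Qed.

Lemma over_inst Su Sb P f :
  over Su Sb (inst P f) = over (fun j => Su (slot j P)) (fun j => Sb (slot j P)) f.
Proof. by elim: f => //= *; congr (_ && _). Qed.

Lemma over_sub (Su Su' Sb Sb' : pred nat) f : {subset Su <= Su'} -> {subset Sb <= Sb'} ->
  over Su Sb f -> over Su' Sb' f.
Proof.
move=> hu hb; rewrite !overP => /and4P[-> -> /allP h1 /allP h2] /=.
by apply/andP; split; apply/allP => i hi; [apply/hu/h1 | apply/hb/h2].
Qed.

Section Over.

Variables (U B : seq nat) (Su Sb : pred nat).

Lemma over_subst tu tb f :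
  (forall P v, P \in U -> over Su Sb (inst P (tu v))) ->
  (forall R v, R \in B -> over Su Sb (inst R (tb v))) ->
  over (mem U) (mem B) f -> over Su Sb (subst_atoms tu tb f).
Proof.
move=> hu hb; elim: f => //= [R a b|g IHg h IHh|g IHg h IHh|g IHg h IHh|g IHg h IHh].
- by move=> /andP[_]; apply: hb.
- by move=> /andP[/IHg -> /IHh ->].
- by move=> /andP[/IHg -> /IHh ->].
- by move=> /andP[/IHg -> /IHh ->].
- by move=> /andP[/IHg -> /IHh ->].
Qed.

Definition over_pair (P : nat) (t : fo2 * fo2) : bool :=
  over Su Sb (inst P t.1) && over Su Sb (inst P t.2).

Lemma over_fold tu tb base s :
  (forall P v, P \in U -> over_pair P (tu v)) ->
  (forall R v, R \in B -> over_pair R (tb v)) ->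
  all (fun a : atom => let: (i, P, _) := a in P \in if i then B else U) s ->
  over Su Sb base -> over Su Sb (fold_atoms tu tb base s).
Proof.
move=> hu hb hs hbase; elim: s hs => //= -[[i P] v] s IH /andP[hP /IH{}IH].
rewrite /fold_step /= IH andbT; case: i hP => hP; [exact: hb | exact: hu].
Qed.

End Over.

Lemma atoms_over f :
  all (fun a : atom => let: (i, P, _) := a in
    P \in if i then binary_occ f else unary_occ f) (atoms f).
Proof.
have sub (U U' B B' : seq nat) s : {subset U <= U'} -> {subset B <= B'} ->
    all (fun a : atom => let: (i, P, _) := a in P \in if i then B else U) s ->
    all (fun a : atom => let: (i, P, _) := a in P \in if i then B' else U') s.
  by move=> hu hb; apply: sub_all => -[[[] P] v]; [apply: hb | apply: hu].
elim: f => //= [P a|R a b|g hg h hh|g hg h hh|g hg h hh|g hg h hh];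
  rewrite ?mem_seq1 ?eqxx // all_cat;
  apply/andP; split; [apply: sub hg|apply: sub hh|apply: sub hg|apply: sub hh
    |apply: sub hg|apply: sub hh|apply: sub hg|apply: sub hh] => i hi;
  by rewrite mem_cat hi ?orbT.
Qed.

Definition un_names (U B : seq nat) : seq nat :=
  [seq fresh j P | j <- iota 0 3, P <- U] ++ [seq fresh j R | j <- iota 3 4, R <- B] ++
  [seq fresh 7 i | i <- iota 0 3].

Definition bin_names (B : seq nat) : seq nat := [seq fresh j R | j <- iota 0 2, R <- B].

Definition un_template (f : fo2) : bool :=
  over (fun j => (j < 3) || (7 <= j < 10)) pred0 f.

Definition bin_template (f : fo2) : bool :=
  over (fun j => 3 <= j < 10) (fun j => j < 2) f.

Lemma over_un_template U B P f : P \in U -> un_template f ->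
  over (mem (un_names U B)) (mem (bin_names B)) (inst P f).
Proof.
move=> hP; rewrite over_inst; apply: over_sub => // j hj.
suff : slot j P \in un_names U B by [].
rewrite /slot; case: ifP => j7; rewrite mem_cat [X in _ || X]mem_cat.
  apply/orP; left; apply/allpairsP; exists (j, P).
  by rewrite mem_iota /=; split=> //; move: hj; rewrite unfold_in; lia.
apply/orP; right; apply/orP; right; apply/mapP; exists (j - 7) => //.
by rewrite mem_iota; move: hj; rewrite unfold_in; lia.
Qed.

Lemma over_bin_template U B R f : R \in B -> bin_template f ->
  over (mem (un_names U B)) (mem (bin_names B)) (inst R f).
Proof.
move=> hR; rewrite over_inst; apply: over_sub => j hj.
  suff : slot j R \in un_names U B by [].
  rewrite /slot; case: ifP => j7; rewrite mem_cat [X in _ || X]mem_cat; apply/orP; right; apply/orP; [left|right].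
    apply/allpairsP; exists (j, R).
    by rewrite mem_iota /=; split=> //; move: hj; rewrite unfold_in; lia.
  apply/mapP; exists (j - 7) => //.
  by rewrite mem_iota; move: hj; rewrite unfold_in; lia.
suff : slot j R \in bin_names B by [].
rewrite /slot ifT; last by move: hj; rewrite unfold_in; lia.
by apply/allpairsP; exists (j, R); rewrite mem_iota /=; split.
Qed.

Lemma over_flagged U B i v : i < 3 -> over (mem (un_names U B)) (mem (bin_names B)) (flagged i v).
Proof.
move=> hi; suff : fresh 7 i \in un_names U B by [].
rewrite mem_cat [X in _ || X]mem_cat; apply/orP; right; apply/orP; right.
by apply/mapP; exists i => //; rewrite mem_iota.
Qed.

Lemma over_reduced U B g a s sb :
  over (mem U) (mem B) g -> over (mem U) (mem B) a ->
  all (fun a : atom => let: (i, P, _) := a in P \in if i then B else U) s ->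
  all (fun a : atom => let: (i, P, _) := a in P \in if i then B else U) sb ->
  over (mem (un_names U B)) (mem (bin_names B)) (reduced g a s sb).
Proof.
move=> hg ha hs hsb.
have hf i v : i < 3 -> over (mem (un_names U B)) (mem (bin_names B)) (flagged i v).
  exact: over_flagged.
have hsubst tu tb f : over (mem U) (mem B) f -> un_template (tu vx) && un_template (tu vy) ->
    bin_template (tb vx) && bin_template (tb vy) ->
    over (mem (un_names U B)) (mem (bin_names B)) (subst_atoms tu tb f).
  move=> hh /andP[h1 h2] /andP[h3 h4]; apply: over_subst hh => [P|R] [] hP.
  - exact: over_un_template.
  - exact: over_un_template.
  - exact: over_bin_template.
  - exact: over_bin_template.
have hfold tu tb base s' :
    all (fun a : atom => let: (i, P, _) := a in P \in if i then B else U) s' ->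
    all (fun v => un_template (tu v).1 && un_template (tu v).2) [:: vx; vy] ->
    all (fun v => bin_template (tb v).1 && bin_template (tb v).2) [:: vx; vy] ->
    over (mem (un_names U B)) (mem (bin_names B)) base ->
    over (mem (un_names U B)) (mem (bin_names B)) (fold_atoms tu tb base s').
  move=> hs' /and3P[/andP[h1 h2] /andP[h3 h4] _] /and3P[/andP[h5 h6] /andP[h7 h8] _].
  apply: over_fold hs' => [P|R] [] hP; apply/andP; split;
    by [apply: over_un_template | apply: over_bin_template].
have substT tu tb f h1 h2 h3 := hsubst tu tb f h1 h2 h3 : _ = true.
have fg : over (mem (un_names U B)) (mem (bin_names B)) (subst_atoms un_src bin_cell g).
  by apply: (hsubst).
rewrite /reduced /forall_xy /forall_exists; cbn [over].
rewrite fg !substT //; repeat (apply/andP; split); try exact: hf; try exact: (hf _ vx); try by [].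
- by apply: (hfold) => //; apply/andP; split; apply: (hf _ vx).
- by apply: (hfold) => //; apply: (hfold).
- exact: (hfold).
- by apply: (hfold) => //; do ![apply/andP; split]; apply: (hf _ vx).
- exact: (hfold).
- apply: (hfold) => //; do ![apply/andP; split]; try exact: (hf _ vx).
  apply: (hfold) => //; apply/andP; split; first exact: (hf 2 vx).
  exact: (hfold).
Qed.

Lemma over_normal_form (U B : seq nat) f :
  equality_free f -> diagonal_free f -> {subset unary_occ f <= U} ->
  {subset binary_occ f <= B} -> over (mem U) (mem B) f.
Proof.
by move=> he hd hu hb; rewrite overP he hd /=; apply/andP; split; apply/allP.
Qed.

Lemma num_occ_le (s t : seq nat) : all (mem t) s -> size (undup s) <= size t.
Proof.
move=> /allP h; apply: uniq_leq_size (undup_uniq s) _ => i.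
by rewrite mem_undup => /h.
Qed.

Lemma over_reduction f : in_normal_form f ->
  over (mem (un_names (undup (unary_occ f)) (undup (binary_occ f))))
    (mem (bin_names (undup (binary_occ f)))) (reduction f).
Proof.
have sub s b : all (fun a : atom => let: (i, P, _) := a in
      P \in if i then binary_occ f else unary_occ f) s ->
    all (fun a : atom => let: (i, P, _) := a in
      P \in if i then undup (binary_occ f) else undup (unary_occ f)) (drop b s).
  move=> h; apply/allP => x /mem_drop hx; move/allP: h => /(_ _ hx).
  by case: x hx => [[[] P] v] _; rewrite mem_undup.
have hall := atoms_over f.
move=> [g [a [s [e /and4P[_ eg dg _] /and3P[_ ea da] _ _]]]].
set b := bigand [seq FAll vx (FEx vy (FAnd b neq_xy)) | b <- s] in e *.
have ea' : atoms f = (atoms g ++ atoms a) ++ atoms b by rewrite e /= catA.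
have -> : reduction f = reduced g a (atoms f) (atoms b) by rewrite {1}e ea' /= catA.
apply: over_reduced.
- by apply: over_normal_form => // i hi; rewrite mem_undup e /= !mem_cat hi ?orbT.
- by apply: over_normal_form => // i hi; rewrite mem_undup e /= !mem_cat hi ?orbT.
- by have := sub _ 0 hall; rewrite drop0.
- have := sub _ (size (atoms g ++ atoms a)) hall.
  by rewrite ea' drop_size_cat.
Qed.

Lemma num_predicates_reduction f : in_normal_form f ->
  num_predicates (reduction f) <= 12 * (num_unary f + num_binary f).
Proof.
move=> hf; have := over_reduction hf; rewrite overP => /and4P[_ _ hu hb].
(* The existence of a binary predicate absorbs the three flags in $3n+4k+3+2k\le 12(n+k)$. *)
have hk : 0 < num_binary f by case: hf => g [a [s [_ _ _ _ /andP[h1 h2]]]]; lia.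
have := num_occ_le hu; have := num_occ_le hb.
rewrite /num_predicates /num_unary /num_binary in hk *.
rewrite /= !size_cat !size_map /= => h1 h2; move: h1 h2 hk.
move: (size (undup (binary_occ (reduction f)))) (size (undup (unary_occ (reduction f)))).
by move: (size (undup (binary_occ f))) (size (undup (unary_occ f))) => k n b u; lia.
Qed.

Lemma sentence_reduction f : in_normal_form f -> sentence (reduction f).
Proof.
have closed v (g : fo2) : (free v (forall_xy g) = false) * (free v (forall_exists g) = false).
  by case: v; split.
move=> [g [a [s [-> _ _ _ _]]]].
by rewrite /sentence /reduction /normal_form /reduced; cbn [free]; rewrite !closed.
Qed.

(** * Semantics of the reduced sentence *)

(* [s] and [t] are the unary types of [x] and [y], and [r], [r'] give the truth
   values of [R(x,y)] and [R(y,x)]. *)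
Fixpoint qeval (s t r r' : nat -> Prop) (f : fo2) : Prop :=
  match f with
  | FTrue => True
  | FFalse => False
  | FEq _ _ | FAll _ _ | FEx _ _ => True
  | FUn P a => if a is vx then s P else t P
  | FBin R a _ => if a is vx then r R else r' R
  | FNot g => ~ qeval s t r r' g
  | FAnd g h => qeval s t r r' g /\ qeval s t r r' h
  | FOr g h => qeval s t r r' g \/ qeval s t r r' h
  | FImp g h => qeval s t r r' g -> qeval s t r r' h
  | FIff g h => qeval s t r r' g <-> qeval s t r r' h
  end.

Lemma qeval_ext s t r r' s' t' r1 r1' f :
  {in unary_occ f, forall P, (s P <-> s' P) /\ (t P <-> t' P)} ->
  {in binary_occ f, forall R, (r R <-> r1 R) /\ (r' R <-> r1' R)} ->
  qeval s t r r' f <-> qeval s' t' r1 r1' f.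
Proof.
have in_cat (A B : seq nat) (Q : nat -> Prop) :
  {in A ++ B, forall P, Q P} -> {in A, forall P, Q P} /\ {in B, forall P, Q P}.
  by move=> h; split=> P hP; apply: h; rewrite mem_cat hP ?orbT.
elim: f => //= [P a|R a b|g IH|g IHg h IHh|g IHg h IHh|g IHg h IHh|g IHg h IHh].
- by move=> /(_ P (mem_head _ _)) [h1 h2] _; case: a.
- by move=> _ /(_ R (mem_head _ _)) [h1 h2]; case: a.
- by move=> hu hb; rewrite IH.
- by move=> /in_cat[u1 u2] /in_cat[b1 b2]; rewrite IHg ?IHh.
- by move=> /in_cat[u1 u2] /in_cat[b1 b2]; rewrite IHg ?IHh.
- by move=> /in_cat[u1 u2] /in_cat[b1 b2]; rewrite IHg ?IHh.
- by move=> /in_cat[u1 u2] /in_cat[b1 b2]; rewrite IHg ?IHh.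
Qed.

(** Without diagonal atoms every binary atom contains [y], so the only predicate atoms here are
    unary ones on [x]. *)
Lemma qeval_x s t t' r r' r1 r1' f : quantifier_free f -> equality_free f ->
  diagonal_free f -> ~~ free vy f ->
  qeval s t r r' f <-> qeval s t' r1 r1' f.
Proof.
elim: f => //= [P [] //|R [] [] //|g IH|g IHg h IHh|g IHg h IHh|g IHg h IHh|g IHg h IHh].
- by move=> q e d n; rewrite IH.
all: move=> /andP[q1 q2] /andP[e1 e2] /andP[d1 d2]; rewrite negb_or => /andP[n1 n2].
all: by rewrite IHg ?IHh.
Qed.

Lemma holds_qeval (M : structure) (e : var -> dom M) f : quantifier_free f ->
  equality_free f -> diagonal_free f ->
  holds e f <-> qeval (fun P => unary_interp P (e vx)) (fun P => unary_interp P (e vy))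
    (fun R => binary_interp R (e vx) (e vy)) (fun R => binary_interp R (e vy) (e vx)) f.
Proof.
elim: f => //= [P [] //|R [] [] //|g IH|g IHg h IHh|g IHg h IHh|g IHg h IHh|g IHg h IHh].
- by move=> q e' d; rewrite IH.
all: move=> /andP[q1 q2] /andP[e1 e2] /andP[d1 d2].
all: by rewrite IHg ?IHh.
Qed.

Lemma holds_subst (M : structure) (e : var -> dom M) tu tb f :
  quantifier_free f -> equality_free f ->
  holds e (subst_atoms tu tb f) <->
  qeval (fun P => holds e (inst P (tu vx))) (fun P => holds e (inst P (tu vy)))
    (fun R => holds e (inst R (tb vx))) (fun R => holds e (inst R (tb vy))) f.
Proof.
elim: f => //= [P [] //|R [] //|g IH|g IHg h IHh|g IHg h IHh|g IHg h IHh|g IHg h IHh].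
- by move=> q e'; rewrite IH.
all: move=> /andP[q1 q2] /andP[e1 e2].
all: by rewrite IHg ?IHh.
Qed.

(** * Semantics of folds *)

Definition un_of (s : seq atom) : seq nat := [seq a.1.2 | a <- s & ~~ a.1.1].
Definition bin_of (s : seq atom) : seq nat := [seq a.1.2 | a <- s & a.1.1].

Lemma un_of_atoms f : un_of (atoms f) = unary_occ f.
Proof. by elim: f => //= *; rewrite /un_of filter_cat map_cat; congr (_ ++ _). Qed.

Lemma bin_of_atoms f : bin_of (atoms f) = binary_occ f.
Proof. by elim: f => //= *; rewrite /bin_of filter_cat map_cat; congr (_ ++ _). Qed.

Section Folds.

Variables (M : structure) (e : var -> dom M).

Lemma in_cons_forall (x : nat) (s : seq nat) (Q : nat -> Prop) :
  {in x :: s, forall y, Q y} <-> Q x /\ {in s, forall y, Q y}.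
Proof.
split=> [h|[hx hs] y]; last by rewrite inE => /predU1P[->|/hs].
by split=> [|y hy]; apply: h; rewrite inE ?eqxx ?hy ?orbT.
Qed.

Lemma in_cons_exists (x : nat) (s : seq nat) (Q : nat -> Prop) :
  (exists2 y, y \in x :: s & Q y) <-> Q x \/ (exists2 y, y \in s & Q y).
Proof.
split=> [[y]|[hx|[y hy hQ]]]; last by exists y; rewrite ?inE ?hy ?orbT.
  by rewrite inE => /predU1P[->|hy] hQ; [left|right; exists y].
by exists x; rewrite ?inE ?eqxx.
Qed.

Lemma holds_conj fu fb base s : holds e (fold_atoms (conj fu) (conj fb) base s) <->
  [/\ {in un_of s, forall P, holds e (inst P fu)},
      {in bin_of s, forall R, holds e (inst R fb)} & holds e base].
Proof.
elim: s => [|[[[] P] v] s IH] /=; first by split=> [hb|[]].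
- rewrite IH; split=> [[//|[h [h1 h2 h3]]]|[h1 /in_cons_forall[h2 h3] h4]].
    by split=> //; apply/in_cons_forall.
  by right.
- rewrite IH; split=> [[//|[h [h1 h2 h3]]]|[/in_cons_forall[h2 h3] h1 h4]].
    by split=> //; apply/in_cons_forall.
  by right.
Qed.

Lemma holds_disj fu fb base s : holds e (fold_atoms (disj fu) (disj fb) base s) <->
  [\/ exists2 P, P \in un_of s & holds e (inst P fu),
      exists2 R, R \in bin_of s & holds e (inst R fb) | holds e base].
Proof.
elim: s => [|[[[] P] v] s IH] /=; first by split=> [hb|[[]|[]|]] //; constructor 3.
- rewrite IH; split=> [[h|[_ [h|h|h]]]|[h|/in_cons_exists[h|h]|h]].
  + by constructor 2; apply/in_cons_exists; left.
  + by constructor 1.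
  + by constructor 2; apply/in_cons_exists; right.
  + by constructor 3.
  + by right; split=> //; constructor 1.
  + by left.
  + by right; split=> //; constructor 2.
  + by right; split=> //; constructor 3.
- rewrite IH; split=> [[h|[_ [h|h|h]]]|[/in_cons_exists[h|h]|h|h]].
  + by constructor 1; apply/in_cons_exists; left.
  + by constructor 1; apply/in_cons_exists; right.
  + by constructor 2.
  + by constructor 3.
  + by left.
  + by right; split=> //; constructor 1.
  + by right; split=> //; constructor 2.
  + by right; split=> //; constructor 3.
Qed.

Definition direction_bit (v : var) : bool := if v is vx then true else false.

Lemma holds_met base s : holds e (fold_atoms skip met base s) <->
  {in s, forall a : atom, a.1.1 -> holds e (inst a.1.2 (met a.2).2)} /\ holds e base.
Proof.
elim: s => [|[[i P] v] s IH] /=; first by split=> [hb|[]].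
split=> [h|[h1 h2]].
  have [h3 h4] : (i -> holds e (inst P (met v).2)) /\ holds e (fold_atoms skip met base s).
    by case: i h => /= -[|[]].
  have [h5 h6] := IH.1 h4; split=> // a; rewrite inE => /predU1P[->|/h5] //.
have hs : holds e (fold_atoms skip met base s).
  by apply/IH; split=> // a ha; apply: h1; rewrite inE ha orbT.
right; split=> //; have := h1 (i, P, v) (mem_head _ _).
by case: i {h1} => //= h; apply: h.
Qed.

(** * Lexicographic comparison of types *)

Fixpoint lex_lt (U : seq nat) (s t : nat -> Prop) (base : Prop) : Prop :=
  if U is P :: U' then (~ s P /\ t P) \/ ((s P <-> t P) /\ lex_lt U' s t base)
  else base.

Lemma holds_lex base s : holds e (fold_atoms lex_tgt skip base s) <->
  lex_lt (un_of s) (fun P => holds e (inst P (tgt vx))) (fun P => holds e (inst P (tgt vy)))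
    (holds e base).
Proof.
elim: s => [|[[[] P] v] s IH] //=; last by rewrite IH.
by rewrite IH; split=> [[|[]]|] //; right.
Qed.

End Folds.

Lemma lex_lt_base U s t (b b' : Prop) : (b -> b') -> lex_lt U s t b -> lex_lt U s t b'.
Proof. by move=> h; elim: U => //= P U IH [|[e /IH]]; [left|right]. Qed.

(** A type read as a binary number, the first predicate being the most significant digit; this turns
    the lexicographic order into that of numbers, even when [U] has repetitions. *)
Fixpoint rank (U : seq nat) (s : nat -> Prop) : nat :=
  if U is P :: U' then `[< s P >] * 2 ^ size U' + rank U' s else 0.

Lemma rank_lt U s : rank U s < 2 ^ size U.
Proof. by elim: U => //= P U IH; rewrite expnS; case: asbool => /=; lia. Qed.

Lemma rank_eq U s t : rank U s = rank U t <-> {in U, forall P, s P <-> t P}.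
Proof.
split=> [h P|]; last first.
  elim: U => //= P U IH h; rewrite IH => [|Q hQ]; last by apply: h; rewrite inE hQ orbT.
  by congr (_ * _ + _); congr nat_of_bool; apply/asbool_equiv_eq/h/mem_head.
elim: U h => //= Q U IH h.
have hs := rank_lt U s; have ht := rank_lt U t.
have [hQ hU] : `[< s Q >] = `[< t Q >] /\ rank U s = rank U t.
  by move: h; case: asbool; case: asbool => /=; rewrite ?mul0n ?mul1n; split=> //; lia.
rewrite inE => /predU1P[->|]; last exact: IH.
by split=> /asboolP; [rewrite hQ | rewrite -hQ] => /asboolP.
Qed.

Lemma lex_ltP U s t base : lex_lt U s t base <->
  rank U s < rank U t \/ ({in U, forall P, s P <-> t P} /\ base).
Proof.
rewrite -rank_eq; elim: U => [|P U IH] /=.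
  by split=> [|[//|[]]//]; right.
have hs := rank_lt U s; have ht := rank_lt U t; rewrite IH => {IH}.
case: asboolP => hsP; case: asboolP => htP /=; rewrite ?mul0n ?mul1n; split.
- by case=> [[]//|[_ [h|[h hb]]]]; [left; lia|right; split=> //; lia].
- by case=> [h|[h hb]]; right; split=> //; [left; lia|right; split=> //; lia].
- by case=> [[]//|[[h _]]]; case: (htP (h hsP)).
- by case=> [h|[h hb]]; lia.
- by move=> _; left; lia.
- by move=> _; left.
- by case=> [[]//|[_ [h|[h hb]]]]; [left; lia|right; split=> //; lia].
- by case=> [h|[h hb]]; right; split=> //; [left; lia|right; split=> //; lia].
Qed.

(** * Models of the reduced sentence as searches *)

Record search : Type := Search {
  pt : Type;
  s_src : nat -> pt -> Prop;
  s_excl : nat -> pt -> Prop;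
  s_tgt : nat -> pt -> Prop;
  s_fwd : nat -> pt -> Prop;
  s_bwd : nat -> pt -> Prop;
  s_dfwd : nat -> pt -> Prop;
  s_dbwd : nat -> pt -> Prop;
  s_init : pt -> Prop;
  s_ksrc : pt -> Prop;
  s_ktgt : pt -> Prop;
  s_rf : nat -> pt -> pt -> Prop;
  s_rb : nat -> pt -> pt -> Prop
}.

Arguments s_src {_}.
Arguments s_excl {_}.
Arguments s_tgt {_}.
Arguments s_fwd {_}.
Arguments s_bwd {_}.
Arguments s_dfwd {_}.
Arguments s_dbwd {_}.
Arguments s_init {_}.
Arguments s_ksrc {_}.
Arguments s_ktgt {_}.
Arguments s_rf {_}.
Arguments s_rb {_}.

Definition search_of (N : structure) : search :=
  @Search (dom N) (fun P x => unary_interp (fresh 0 P) x) (fun P x => unary_interp (fresh 1 P) x)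
    (fun P x => unary_interp (fresh 2 P) x) (fun P x => unary_interp (fresh 3 P) x)
    (fun P x => unary_interp (fresh 4 P) x) (fun P x => unary_interp (fresh 5 P) x)
    (fun P x => unary_interp (fresh 6 P) x) (fun x => unary_interp (fresh 7 0) x)
    (fun x => unary_interp (fresh 7 1) x) (fun x => unary_interp (fresh 7 2) x)
    (fun P x y => binary_interp (fresh 0 P) x y) (fun P x y => binary_interp (fresh 1 P) x y).

Section Correct.

Variables (g a : fo2) (U B : seq nat) (req : seq (nat * bool)) (S : search).
Implicit Types x y : pt S.

Definition s_met (b : nat * bool) x : Prop :=
  if b.2 then s_dfwd b.1 x else s_dbwd b.1 x.

Definition king_step x : Prop := ~ s_init x /\ s_ksrc x /\ s_ktgt x.

Record correct : Prop := Correct {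
  c_gamma : forall x, qeval (s_src ^~ x) (s_src ^~ x) (fun=> True) (fun=> True) g;
  c_step : forall x, s_init x \/
    qeval (s_src ^~ x) (s_tgt ^~ x) (s_fwd ^~ x) (s_bwd ^~ x) a /\
    qeval (s_tgt ^~ x) (s_src ^~ x) (s_bwd ^~ x) (s_fwd ^~ x) a;
  c_pair : forall x y,
    ({in U, forall P, s_src P x <-> s_src P y} /\ s_ksrc x /\ s_ksrc y) \/
    qeval (s_src ^~ x) (s_src ^~ y) (fun R => s_rf R x y) (fun R => s_rb R x y) a /\
    qeval (s_src ^~ y) (s_src ^~ x) (fun R => s_rb R x y) (fun R => s_rf R x y) a;
  c_kings : forall x y, king_step x -> king_step y ->
    {in U, forall P, (s_src P x <-> s_tgt P y) /\ (s_tgt P x <-> s_src P y)} ->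
    {in B, forall R, (s_fwd R x <-> s_bwd R y) /\ (s_bwd R x <-> s_fwd R y)};
  c_excl : forall x, ~ s_init x -> s_ktgt x ->
    exists2 P, P \in U & ~ (s_excl P x <-> s_tgt P x);
  c_birth : forall x, exists y, [/\ s_init y, s_init x \/ (s_ksrc y <-> s_ktgt x),
    {in U, forall P, (s_ksrc y -> (s_excl P y <-> s_src P y)) /\
      (s_init x \/ (s_src P y <-> s_tgt P x) /\
         (s_ksrc x /\ ~ s_ktgt x -> (s_excl P y <-> s_src P x)))} &
    {in B, forall R, (s_dfwd R y -> ~ s_init x /\ ~ s_ktgt x /\ s_bwd R x) /\
      (s_dbwd R y -> ~ s_init x /\ ~ s_ktgt x /\ s_fwd R x)}];
  c_next : forall x, {in req, forall b, s_met b x} \/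
    exists y, [/\ ~ s_init y, s_ksrc x <-> s_ksrc y,
      {in U, forall P, (s_src P x <-> s_src P y) /\ (s_excl P x <-> s_excl P y)},
      {in B, forall R, (s_dfwd R y <-> s_dfwd R x \/ s_fwd R y) /\
                       (s_dbwd R y <-> s_dbwd R x \/ s_bwd R y)} &
      s_init x \/ lex_lt U (s_tgt ^~ x) (s_tgt ^~ y)
        (~ s_ktgt x /\ exists2 R, R \in B &
           (~ s_dfwd R x /\ s_dfwd R y) \/ (~ s_dbwd R x /\ s_dbwd R y))]
}.

End Correct.

Definition requirements (s : seq atom) : seq (nat * bool) :=
  [seq (a.1.2, direction_bit a.2) | a <- s & a.1.1].

Lemma models_reduced (N : structure) g a s sb :
  quantifier_free g -> equality_free g -> diagonal_free g -> ~~ free vy g ->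
  quantifier_free a -> equality_free a ->
  models N (reduced g a s sb) <->
  correct g a (un_of s) (bin_of s) (requirements sb) (search_of N).
Proof.
move=> qg eg dg ng qa ea; rewrite /reduced.
have modelsA f1 f2 : models N (FAnd f1 f2) <-> models N f1 /\ models N f2.
  by split=> [h|[h1 h2] e]; [split=> e; case: (h e) | split].
have [x0] := dom_nonempty N.
pose env (x y : dom N) v := if v is vx then x else y.
have envE (e : var -> dom N) x y : update (update e vx x) vy y = env x y.
  by apply: funext => -[].
have models_forall f : models N (forall_xy f) <-> forall x y, holds (env x y) f.
  by split=> [h x y|h e /= x y]; [rewrite -(envE (fun=> x0)); exact: (h (fun=> x0) x y) | rewrite envE].
have models_exists f : models N (forall_exists f) <-> forall x, exists y, holds (env x y) f.
  split=> [h x|h e /= x].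
    by have [y hy] := h (fun=> x0) x; exists y; rewrite -(envE (fun=> x0)).
  by have [y hy] := h x; exists y; rewrite envE.
rewrite !modelsA !models_forall !models_exists.
split.
- case=> h1 [h2 [h3 [h4 [h5 [h6 h7]]]]]; split.
  + move=> x; have := h1 x x; rewrite holds_subst //.
    exact: (qeval_x _ _ _ _ _ _ _ qg eg dg ng).1.
  + move=> x; case: (h2 x x) => [|[/(holds_subst _ _ _ qa ea) k1 /(holds_subst _ _ _ qa ea) k2]];
      [by left | by right].
  (* [skip] is convertible to [conj FTrue] and to [disj FFalse], so the fold lemmas also cover
     one-sided folds. *)
  + move=> x y; case: (h3 x y) => [/(holds_conj _ _ FTrue)[h _ [k1 k2]]|]; first by left.
    by move=> [/(holds_subst _ _ _ qa ea) k1 /(holds_subst _ _ _ qa ea) k2]; right.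
  + move=> x y [i1 [k1 k2]] [i2 [k3 k4]] hst; case: (h4 x y) => [[]|]; first by [].
    move=> /(holds_disj _ _ FFalse)[[P hP hn]|[]//|/(holds_conj _ FTrue)[_ h _]].
      by case: hn; case: (hst P hP).
    exact: h.
  + move=> x hi hk; case: (h5 x x) => [[//|/(_ hk)//]|/(holds_disj _ _ FFalse)[[P hP h]|[]//|//]].
    by exists P.
  + move=> x; have [y /holds_conj[hu hb [hy hk]]] := h6 x; exists y; split=> //.
  + move=> x; have [y [/holds_met[h _]|/holds_conj[hu hb [[hi hk] hl]]]] := h7 x.
      left=> b /mapP[[[i P] v]]; rewrite mem_filter /= => /andP[hi /h /(_ hi)].
      by move=> hm ->; case: v hm.
    right; exists y; split=> //.
    case: hl => [|/holds_lex hl]; [by left|right].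
    apply: lex_lt_base hl => -[hkt /(holds_disj _ FFalse)[[]//|[R hR hp]|//]].
    by split=> //; exists R.
- case=> h1 h2 h3 h4 h5 h6 h7; split; last split; last split; last split; last split; last split.
  + move=> x y; rewrite holds_subst //.
    by apply/(qeval_x _ _ _ _ _ _ _ qg eg dg ng)/h1.
  + move=> x y; case: (h2 x) => [|h]; first by left.
    by right; split; apply/holds_subst => //; case: h.
  + move=> x y; case: (h3 x y) => [[h [k1 k2]]|h]; first by left; apply/(holds_conj _ _ FTrue).
    by right; split; apply/holds_subst => //; case: h.
  + move=> x y.
    case: (pselect (king_step (S := search_of N) x /\ king_step (S := search_of N) y)) => hk;
      last by left.
    right; apply/(holds_disj _ _ FFalse).
    case: (pselect (exists2 P, P \in un_of s & holds (env x y) (inst P not_reversed))) => hP;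
      first by constructor 1.
    constructor 3; apply/(holds_conj _ FTrue); split=> //.
    apply: h4 => [||P hPs]; [by case: hk|by case: hk|].
    by apply: contrapT => hn; apply: hP; exists P => // hn'; apply: hn.
  + move=> x y; case: (pselect (s_init (s := search_of N) x)) => hi; first by left; left.
    case: (pselect (s_ktgt (s := search_of N) x)) => hk; last by left; right.
    by right; apply/(holds_disj _ _ FFalse); have [P] := h5 x hi hk; constructor 1; exists P.
  + move=> x; have [y [hi hk hu hb]] := h6 x; exists y; apply/holds_conj; split=> //.
  + move=> x; case: (h7 x) => [h|[y [hi hk hu hb hl]]].
      (* Every requirement is met at [x], so any element will do as [y]. *)
      exists x; left; apply/holds_met; split=> // -[[i P] v] ha /= hi'.
      have : (P, direction_bit v) \in requirements sb.
        by apply/mapP; exists (i, P, v) => //; rewrite mem_filter /= ha hi'.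
      by move=> /h; case: (v).
    exists y; right; apply/holds_conj; split=> //; split=> //.
    case: hl => hl; [by left|right]; apply/holds_lex.
    apply: lex_lt_base hl => -[hkt [R hR hp]]; split=> //.
    by apply/(holds_disj _ FFalse); constructor 2; exists R.
Qed.

(** Inverts [fresh]: the remainder modulo 16 is [8 + j], the quotient is the predicate or the number
    of the flag. *)
Definition structure_of (S : search) (h : inhabited (pt S)) : structure :=
  @Structure (pt S) h
    (fun i x => let P := i %/ 16 in
      match i %% 16 - 8 with
      | 0 => s_src P x | 1 => s_excl P x | 2 => s_tgt P x | 3 => s_fwd P x
      | 4 => s_bwd P x | 5 => s_dfwd P x | 6 => s_dbwd P x
      | _ => match P with 0 => s_init x | 1 => s_ksrc x | _ => s_ktgt x end
      end)
    (fun i x y => if i %% 16 - 8 is 0 then s_rf (i %/ 16) x y else s_rb (i %/ 16) x y).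

Lemma fresh_div j P : j < 8 -> fresh j P %/ 16 = P.
Proof. by rewrite /fresh; lia. Qed.

Lemma fresh_mod j P : j < 8 -> fresh j P %% 16 - 8 = j.
Proof. by rewrite /fresh; lia. Qed.

Lemma structure_ofK S h : search_of (@structure_of S h) = S.
Proof.
case: S h => D s e t f b df db i ks kt rf rb h; rewrite /search_of /=; f_equal;
  by apply: funext => P; try apply: funext => x; try apply: funext => y;
     rewrite ?fresh_div ?fresh_mod.
Qed.

(** * Semantics of the normal form *)

Definition lit (D : Type) (R : nat -> D -> D -> Prop) (b : nat * bool) (x y : D) : Prop :=
  if b.2 then R b.1 x y else R b.1 y x.

Record normal_model (g a : fo2) (req : seq (nat * bool)) (D : Type)
    (P : nat -> D -> Prop) (R : nat -> D -> D -> Prop) : Prop := NormalModel {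
  n_gamma : forall x, qeval (P ^~ x) (P ^~ x) (fun=> True) (fun=> True) g;
  n_alpha : forall x y, x <> y -> qeval (P ^~ x) (P ^~ y) (fun r => R r x y) (fun r => R r y x) a;
  n_req : {in req, forall b x, exists2 y, x <> y & lit R b x y}
}.

Lemma models_normal_form (M : structure) g a s :
  quantifier_free g -> equality_free g -> diagonal_free g -> ~~ free vy g ->
  quantifier_free a -> equality_free a -> diagonal_free a -> all binary_atom s ->
  models M (normal_form g a s) <->
  normal_model g a
    (requirements (atoms (bigand [seq FAll vx (FEx vy (FAnd b neq_xy)) | b <- s])))
    (@unary_interp M) (@binary_interp M).
Proof.
move=> qg eg dg ng qa ea da hs; rewrite /normal_form.
have modelsA f1 f2 : models M (FAnd f1 f2) <-> models M f1 /\ models M f2.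
  by split=> [h|[h1 h2] e]; [split=> e; case: (h e) | split].
have [x0] := dom_nonempty M.
have hgamma : models M (FAll vx g) <->
    forall x : dom M, qeval ((@unary_interp M) ^~ x) ((@unary_interp M) ^~ x)
      (fun=> True) (fun=> True) g.
  split=> [h x|h e /= x].
    have /holds_qeval := h (fun=> x) x; move=> /(_ qg eg dg).
    exact: (qeval_x _ _ _ _ _ _ _ qg eg dg ng).1.
  by apply/holds_qeval => //; apply/(qeval_x _ _ _ _ _ _ _ qg eg dg ng)/h.
have halpha : models M (FAll vx (FAll vy (FImp neq_xy a))) <->
    forall x y : dom M, x <> y -> qeval ((@unary_interp M) ^~ x) ((@unary_interp M) ^~ y)
      (fun r => binary_interp r x y) (fun r => binary_interp r y x) a.
  split=> [h x y hxy|h e /= x y hxy]; last by apply/holds_qeval => //; apply: h.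
  by have /holds_qeval := h (fun=> x0) x y hxy; apply.
have hreq : models M (bigand [seq FAll vx (FEx vy (FAnd b neq_xy)) | b <- s]) <->
    {in requirements (atoms (bigand [seq FAll vx (FEx vy (FAnd b neq_xy)) | b <- s])),
      forall b (x : dom M), exists2 y, x <> y & lit (@binary_interp M) b x y}.
  have one b : binary_atom b -> models M (FAll vx (FEx vy (FAnd b neq_xy))) <->
      {in requirements (atoms b),
        forall b (x : dom M), exists2 y, x <> y & lit (@binary_interp M) b x y}.
    case: b => // R v w hvw; split=> [h b|h e /= x].
      rewrite inE => /eqP -> x; have [y [hy hn]] := h (fun=> x0) x.
      by exists y => //; clear h; case: v w hvw hy => [] [].
    have [y hn hl] := h _ (mem_head _ _) x; clear h; exists y; split=> //.
    by case: v w hvw hl => [] [].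
  elim: s hs => [_|b [|b' s] IH /andP[hb hs]].
  - by split.
  - by rewrite /= cats0; apply: one.
  - have -> : bigand [seq FAll vx (FEx vy (FAnd b neq_xy)) | b <- [:: b, b' & s]] =
      FAnd (FAll vx (FEx vy (FAnd b neq_xy)))
        (bigand [seq FAll vx (FEx vy (FAnd b neq_xy)) | b <- b' :: s]) by [].
    rewrite modelsA (one _ hb) (IH hs) [atoms (FAnd _ _)]/= cats0.
    rewrite /requirements filter_cat map_cat.
    split=> [[h1 h2] c|h]; first by rewrite mem_cat => /orP[/h1|/h2].
    by split=> c hc; apply: h; rewrite mem_cat hc ?orbT.
rewrite !modelsA hgamma halpha hreq.
by split=> [[h1 [h2 h3]]|[h1 h2 h3]].
Qed.

(** * From models of the normal form to searches *)

Section Searching.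

Variables (g a : fo2) (U B : seq nat) (req : seq (nat * bool)) (D : Type).
Variables (P : nat -> D -> Prop) (R : nat -> D -> D -> Prop).
Hypothesis aU : {subset unary_occ a <= U}.
Hypothesis reqB : {in req, forall b, b.1 \in B}.
Hypothesis HM : normal_model g a req P R.

Definition same_type x y : Prop := {in U, forall p, P p x <-> P p y}.
Definition king x : Prop := forall y, same_type x y -> x = y.
Definition height x : nat := rank U (P ^~ x).

Lemma same_type_sym x y : same_type x y -> same_type y x.
Proof. by move=> h p /h ->. Qed.

Lemma heightE x y : height x = height y <-> same_type x y.
Proof. exact: rank_eq. Qed.

Lemma twin_ex x : exists y, same_type x y /\ (x = y -> king x).
Proof.
case: (pselect (king x)) => [hk|]; first by exists x.
move=> /existsNP[y /not_implyP[h hne]]; by exists y.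
Qed.

(** Two searches may start from the same element; the literals between two copies of [x] are then
    taken from [x] and its twin, which is [x] itself only for a king. *)
Definition twin x : D := projT1 (cid (twin_ex x)).
Definition alt x y : D := if pselect (x = y) then twin x else y.

Lemma alt_same x y : same_type (alt x y) y.
Proof.
rewrite /alt /twin; case: pselect => [e|_] //=.
by case: cid => z /= [/same_type_sym hs _]; rewrite -e.
Qed.

Lemma alt_neq x y : ~ (king x /\ king y /\ same_type x y) -> x <> alt x y.
Proof.
rewrite /alt /twin => hn; case: pselect => [e|//]; case: cid => z /= [hs hz] exz.
by apply: hn; rewrite -e; split; [|split] => //; apply: hz.
Qed.

Record node : Type := Node {
  n_src : D;
  n_excl : D;
  n_cur : option D;
  n_done : nat -> bool -> bool
}.

Definition visitable (n : node) (w : D) : Prop :=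
  w <> n_src n /\ (king w -> w <> n_excl n).

Definition after (c : option D) (w : D) : Prop :=
  if c is Some c then height c < height w \/ (same_type c w /\ ~ king c) else True.

(** The invariant that the search can still be completed: each requirement is met, or keeps a
    permitted witness that comes later in the order. *)
Definition sound (n : node) : Prop :=
  (if n_cur n is Some c then visitable n c else True) /\
  {in req, forall b, n_done n b.1 b.2 \/
    exists w, [/\ visitable n w, lit R b (n_src n) w & after (n_cur n) w]}.

Definition visits (n : {n | sound n}) (Q : D -> Prop) : Prop :=
  if n_cur (sval n) is Some c then Q c else False.

Definition model_search : search :=
  @Search {n | sound n} (fun p n => P p (n_src (sval n))) (fun p n => P p (n_excl (sval n)))
    (fun p n => visits n (P p)) (fun r n => visits n (R r (n_src (sval n))))
    (fun r n => visits n (R r ^~ (n_src (sval n))))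
    (fun r n => n_done (sval n) r true) (fun r n => n_done (sval n) r false)
    (fun n => n_cur (sval n) = None) (fun n => king (n_src (sval n)))
    (fun n => visits n king)
    (fun r n m => R r (n_src (sval n)) (alt (n_src (sval n)) (n_src (sval m))))
    (fun r n m => R r (alt (n_src (sval n)) (n_src (sval m))) (n_src (sval n))).

Lemma sound_start x : sound (Node x x None (fun _ _ => false)).
Proof.
split=> // b hb; right; have [w hw hl] := n_req HM hb x.
by exists w; split=> //; split=> [e|_ e]; apply: hw; rewrite e.
Qed.

(** Requirements met by the parent [x] are credited at birth; a witness of any other requirement
    differs from [x], so excluding [x] loses nothing. *)
Lemma sound_child x c : x <> c -> ~ king c ->
  sound (Node c (if pselect (king x) then x else c) None
    (fun r d => `[< lit R (r, d) c x >])).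
Proof.
move=> hxc hk; split=> // b hb; have [w hw hl] := n_req HM hb c.
case: (pselect (lit R b c x)) => hx; first by left; apply/asboolP; case: b hx {hb hl}.
right; exists w; split=> //; split=> /= [e|hkw]; first by apply: hw; rewrite e.
by case: pselect => hkx /= e; [apply: hx; rewrite -e | apply: hw; rewrite e].
Qed.

(** Greedy choice: visit a witness [w] of least height among those of unmet requirements. The other
    witnesses lie no lower, and if [w] is a king, one of equal height is [w] itself, so that its
    requirement has just been met. *)
Lemma sound_next (n : node) : sound n ->
  ~ {in req, forall b, n_done n b.1 b.2} ->
  exists w b, [/\ b \in req, ~~ n_done n b.1 b.2, lit R b (n_src n) w, after (n_cur n) w &
    sound (Node (n_src n) (n_excl n) (Some w)
      (fun r d => n_done n r d || `[< lit R (r, d) (n_src n) w >]))].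
Proof.
move=> [hc hn] /existsNP[b0 /not_implyP[hb0 hd0]].
pose Q k := exists b w, [/\ b \in req, ~~ n_done n b.1 b.2, lit R b (n_src n) w,
  after (n_cur n) w & visitable n w /\ height w = k].
have [|k] := @ex_minnP (fun k => `[< Q k >]).
  case: (hn b0 hb0) => // -[w [h1 h2 h3]].
  by exists (height w); apply/asboolP; exists b0, w; split=> //; apply/negP.
move=> /asboolP[b [w [hb hd hl ha [hv hk]]]] hmin.
exists w, b; split=> //; split=> //= b' hb'.
case: (hn b' hb') => [->|[w' [h1 h2 h3]]]; first by left.
case: (boolP (n_done n b'.1 b'.2)) => [_|hd']; first by left.
case: (pselect (lit R b' (n_src n) w)) => hx.
  by left; apply/asboolP; case: b' hx {hb' h2 hd'}.
right; exists w'; split=> //=.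
have : k <= height w' by apply: hmin; apply/asboolP; exists b', w'.
rewrite -hk leq_eqVlt => /predU1P[/heightE hs|]; last by left.
by right; split=> // hkw; apply: hx; rewrite (hkw _ hs).
Qed.

Lemma model_search_correct : correct g a U B req model_search.
Proof.
have qa s t r r' s' t' : {in U, forall p, s p <-> s' p} -> {in U, forall p, t p <-> t' p} ->
    qeval s t r r' a -> qeval s' t' r r' a.
  move=> hs ht; apply: (qeval_ext _ _).1 => // p /aU hp.
  by split; [apply: hs | apply: ht].
split.
- by move=> [n hn]; apply: n_gamma HM _.
- move=> [[x p [c|] d] [hc hn]] /=; last by left.
  have /= [hxc _] := hc; right; split; apply: (n_alpha HM); last by [].
  by move=> e; apply: hxc.
- move=> [n hn] [m hm] /=; move: (n_src n) (n_src m) => x y.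
  case: (pselect (king x /\ king y /\ same_type x y)) => [[h1 [h2 h3]]|/alt_neq hne];
    first by left.
  right; have hs := @alt_same x y.
  split; [apply: qa (n_alpha HM hne)|apply: qa (n_alpha HM (nesym hne))] => //.
(* A king is determined by its type, so each of the two steps visits the source of the other. *)
- move=> [[x p [c|] d] hn] [[y q [e|] d'] hm] /= [h1 [h2 h3]] [h4 [h5 h6]] hst //.
  have exe : x = e by apply: (h2) => i /hst[].
  have ecy : c = y by apply: (h3) => i /hst[].
  by move=> r _; rewrite /visits /= exe ecy.
- move=> [[x p [c|] d] [[/= hcx hcp] hn]] //= _ hk.
  apply: contrapT => hnot; apply: (hcp hk); apply: hk => i hi.
  by apply: contrapT => hi'; apply: hnot; exists i => // h; apply: hi'; rewrite h.
- move=> [[x p [c|] d] [hc hn]] /=; last first.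
    exists (exist _ _ (sound_start x)) => /=; split=> //; first by left.
    by move=> i hi; split=> //; left.
  case: (pselect (king c)) => hk.
    exists (exist _ _ (sound_start c)) => /=; split=> //; first by right.
    by move=> i hi; split=> //; right; split=> // -[].
  have hxc : x <> c by case: hc => /= h _ e; apply: h.
  exists (exist _ _ (sound_child hxc hk)) => /=; split=> //; first by right.
    move=> i hi; split=> //; right; split=> // -[hkx _].
    by case: pselect.
  by move=> r hr; split=> /asboolP h; split.
- move=> [n hn]; case: (pselect {in req, forall b, n_done n b.1 b.2}) => hd.
    left=> b /hd; rewrite /s_met /=.
    by case: (b.2).
  right; have [w [b [hb hdb hl ha hs]]] := sound_next hn hd.
  exists (exist _ _ hs) => /=; split=> //.
    by move=> r hr; rewrite /visits /=; split; split=> [/orP[->|/asboolP]|[->|h]] //;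
      try (by left); try (by right); apply/orP; right; apply/asboolP.
  rewrite /visits /=; case: (n_cur n) ha => [c|] /=; last by left.
  case=> [h|[h hk]]; right; apply/lex_ltP; [by left|right; split=> //].
  split=> //; exists b.1; first exact: reqB.
  have h1 : n_done n b.1 b.2 || `[< lit R (b.1, b.2) (n_src n) w >].
    by apply/orP; right; apply/asboolP; case: (b) hl.
  by move: h1 hdb; case: (b.2) => h1 /negP hdb; [left|right].
Qed.

End Searching.

(** * From searches to models of the normal form *)

Lemma count_lt (T : eqType) (p q : pred T) (s : seq T) (x : T) :
  subpred p q -> x \in s -> ~~ p x -> q x -> count p s < count q s.
Proof.
move=> hpq; elim: s => //= y s IH; rewrite inE => /predU1P[->|hx] hp hq.
  by rewrite (negbTE hp) hq add0n add1n ltnS; apply: sub_count.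
have := IH hx hp hq; have := hpq y; case: (p y) => [->|_] //; lia.
Qed.

Section Unravel.

Variables (g a : fo2) (U B : seq nat) (req : seq (nat * bool)) (S : search).
Hypothesis aU : {subset unary_occ a <= U}.
Hypothesis aB : {subset binary_occ a <= B}.
Hypothesis reqB : {in req, forall b, b.1 \in B}.
Hypothesis HS : correct g a U B req S.
Variable x0 : pt S.
Implicit Types x y : pt S.

Definition agree (s t : nat -> Prop) : Prop := {in U, forall P, s P <-> t P}.

Lemma agree_sym s t : agree s t -> agree t s.
Proof. by move=> h P hP; rewrite h. Qed.

Lemma agree_trans s t u : agree s t -> agree t u -> agree s u.
Proof. by move=> h1 h2 P hP; rewrite h1 // h2. Qed.

Lemma rankE s t : rank U s = rank U t <-> agree s t.
Proof. exact: rank_eq. Qed.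

Definition finished x : Prop := {in req, forall b, s_met b x}.

(** * Births, next steps and termination of searches *)

Record birth_spec x y : Prop := BirthSpec {
  b_init : s_init y;
  b_king : s_init x \/ (s_ksrc y <-> s_ktgt x);
  b_excl : s_ksrc y -> agree (s_excl ^~ y) (s_src ^~ y);
  b_src : s_init x \/ agree (s_src ^~ y) (s_tgt ^~ x);
  b_parent : s_init x \/ (s_ksrc x -> ~ s_ktgt x -> agree (s_excl ^~ y) (s_src ^~ x));
  b_dfwd : {in B, forall R, s_dfwd R y -> ~ s_init x /\ ~ s_ktgt x /\ s_bwd R x};
  b_dbwd : {in B, forall R, s_dbwd R y -> ~ s_init x /\ ~ s_ktgt x /\ s_fwd R x}
}.

Lemma birth_ex x : exists y, birth_spec x y.
Proof.
have [y [hi hk hu hb]] := c_birth HS x; exists y.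
split=> //.
- by move=> h P hP; have [h' _] := hu P hP; apply: h'.
- case: (pselect (s_init x)) => hx; [by left|right => P hP].
  by have [_ [|[]]] := hu P hP.
- case: (pselect (s_init x)) => hx; [by left|right => h1 h2 P hP].
  by have [_ [|[_ h]]] := hu P hP => //; apply: h.
- by move=> R hR; case: (hb R hR).
- by move=> R hR; case: (hb R hR).
Qed.

Record next_spec x y : Prop := NextSpec {
  x_init : ~ s_init y;
  x_king : s_ksrc x <-> s_ksrc y;
  x_src : agree (s_src ^~ x) (s_src ^~ y);
  x_excl : agree (s_excl ^~ x) (s_excl ^~ y);
  x_done : {in B, forall R, (s_dfwd R y <-> s_dfwd R x \/ s_fwd R y) /\
                            (s_dbwd R y <-> s_dbwd R x \/ s_bwd R y)};
  x_order : s_init x \/ lex_lt U (s_tgt ^~ x) (s_tgt ^~ y)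
        (~ s_ktgt x /\ exists2 R, R \in B &
           (~ s_dfwd R x /\ s_dfwd R y) \/ (~ s_dbwd R x /\ s_dbwd R y))
}.

Lemma next_ex x : exists y, finished x \/ next_spec x y.
Proof.
have [h|[y [h1 h2 h3 h4 h5]]] := c_next HS x; first by exists x; left.
by exists y; right; split=> // P /h3[].
Qed.

Definition birth x : pt S := projT1 (cid (birth_ex x)).
Definition next x : pt S := projT1 (cid (next_ex x)).

Lemma birthP x : birth_spec x (birth x).
Proof. by rewrite /birth; case: cid. Qed.

Lemma nextP x : finished x \/ next_spec x (next x).
Proof. by rewrite /next; case: cid. Qed.

Definition num_done x : nat :=
  count (fun R => `[< s_dfwd R x >]) B + count (fun R => `[< s_dbwd R x >]) B.

(** A step raises the type of the target or, keeping it, sets a new one of the [2 * size B]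
    requirement bits; the factor makes the type dominate. *)
Definition potential x : nat := rank U (s_tgt ^~ x) * (2 * size B).+1 + num_done x.

Lemma num_done_le x : num_done x <= 2 * size B.
Proof.
by rewrite /num_done mul2n -addnn leq_add // count_size.
Qed.

Lemma potential_lt x : potential x < 2 ^ size U * (2 * size B).+1.
Proof.
have h1 := rank_lt U (s_tgt ^~ x); have h2 := num_done_le x.
rewrite /potential; nia.
Qed.

Lemma num_done_lt x y : next_spec x y ->
  (exists2 R, R \in B & (~ s_dfwd R x /\ s_dfwd R y) \/ (~ s_dbwd R x /\ s_dbwd R y)) ->
  num_done x < num_done y.
Proof.
move=> h [R hR hp]; rewrite /num_done.
have hin (Q : nat -> Prop) :
    count (fun R => `[< Q R >]) B = count (fun R => (R \in B) && `[< Q R >]) B.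
  by apply: eq_in_count => i ->.
rewrite !hin.
have sf : subpred (fun R => (R \in B) && `[< s_dfwd R x >])
    (fun R => (R \in B) && `[< s_dfwd R y >]).
  move=> i /andP[hi /asboolP hs]; rewrite hi; apply/asboolP.
  by apply/(proj1 (x_done h hi)); left.
have sb : subpred (fun R => (R \in B) && `[< s_dbwd R x >])
    (fun R => (R \in B) && `[< s_dbwd R y >]).
  move=> i /andP[hi /asboolP hs]; rewrite hi; apply/asboolP.
  by apply/(proj2 (x_done h hi)); left.
case: hp => -[h1 h2].
  rewrite -addSn; apply: leq_add (sub_count sb _).
  by apply: (count_lt sf hR); rewrite hR /=; [apply/asboolPn | apply/asboolP].
rewrite -addnS; apply: leq_add (sub_count sf _) _.
by apply: (count_lt sb hR); rewrite hR /=; [apply/asboolPn | apply/asboolP].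
Qed.

Lemma potential_next x y : next_spec x y -> ~ s_init x -> potential x < potential y.
Proof.
move=> h hi; have [//|/lex_ltP[hr|[/rankE hr [_ hp]]]] := x_order h.
  by have := num_done_le x; rewrite /potential; nia.
by rewrite /potential hr ltn_add2l; apply: num_done_lt.
Qed.

(** An endless search would raise a bounded potential for ever. Counting begins after the first
    step, because no order is imposed on the step from an initial element. *)
Lemma chain_finishes x : exists n, finished (iter n next x).
Proof.
apply: contrapT => hn.
have spec n : next_spec (iter n next x) (iter n.+1 next x).
  by case: (nextP (iter n next x)) => // hf; case: hn; exists n.
have grow n : n <= potential (iter n.+1 next x).
  elim: n => // n IH; apply: leq_ltn_trans IH _.
  exact: potential_next (spec _) (x_init (spec _)).
by have := grow (2 ^ size U * (2 * size B).+1); rewrite leqNgt potential_lt.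
Qed.

Lemma len_ex x : exists n, finished (iter n next x) /\
  forall i, i < n -> next_spec (iter i next x) (iter i.+1 next x).
Proof.
have h : exists n, `[< finished (iter n next x) >].
  by have [n hn] := chain_finishes x; exists n; apply/asboolP.
exists (ex_minn h); case: ex_minnP => n /asboolP hn hmin; split=> // i hi.
case: (nextP (iter i next x)) => // hf.
by move: hi; rewrite ltnNge => /negP[]; apply: hmin; apply/asboolP.
Qed.

Definition len x : nat := projT1 (cid (len_ex x)).

Lemma len_finished x : finished (iter (len x) next x).
Proof. by rewrite /len; case: cid => n []. Qed.

Lemma lenP x i : i < len x -> next_spec (iter i next x) (iter i.+1 next x).
Proof. exact: (proj2 (projT2 (cid (len_ex x)))). Qed.

(** * Starts, kings and names of persons *)

Record start x : Prop := Start {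
  st_init : s_init x;
  st_excl : s_ksrc x -> agree (s_excl ^~ x) (s_src ^~ x);
  st_done : {in B, forall R, ~ s_dfwd R x /\ ~ s_dbwd R x}
}.

(** Two births are needed: the inner one yields an initial element, and a birth from an initial
    element is credited with no requirement. *)
Definition root : pt S := birth (birth x0).

Lemma start_birth x : s_init x \/ s_ktgt x -> start (birth x).
Proof.
move=> hx; have [h1 h2 h3 h4 h5 h6 h7] := birthP x.
by split=> // R hR; split=> [/(h6 R hR)|/(h7 R hR)] [? [? ?]]; case: hx.
Qed.

Lemma start_root : start root.
Proof. by apply: start_birth; left; apply: b_init (birthP _). Qed.

Definition kingdom (k : nat) (x : pt S) : Prop :=
  [/\ start x, s_ksrc x & rank U (s_src ^~ x) = k].

Definition throne (k : nat) : pt S :=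
  if pselect (exists x, kingdom k x) is left h then projT1 (cid h) else x0.

Lemma throneP k : (exists x, kingdom k x) -> kingdom k (throne k).
Proof. by rewrite /throne; case: pselect => // h _; case: cid. Qed.

(* A king is named by the rank of its type, the base [None] is the root; the
   path lists the positions, in the search of the parent, at which the elements
   that are not kings are introduced. *)
Definition person : Type := (option nat * seq nat)%type.

Fixpoint ini_path (b : option nat) (q : seq nat) : pt S :=
  match q with
  | [::] => if b is Some k then throne k else root
  | i :: q' => birth (iter i.+1 next (ini_path b q'))
  end.

Definition ini (c : person) : pt S := ini_path c.1 c.2.
Definition cell (c : person) (i : nat) : pt S := iter i.+1 next (ini c).

(** If the root is flagged as a king, the base [None] names nobody, and the king of the type of the
    root takes its place. *)
Fixpoint real_path (b : option nat) (q : seq nat) : Prop :=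
  match q with
  | [::] => if b is Some k then exists x, kingdom k x else ~ s_ksrc root
  | i :: q' => [/\ real_path b q', i < len (ini_path b q') &
      ~ s_ktgt (iter i.+1 next (ini_path b q'))]
  end.

Definition real (c : person) : Prop := real_path c.1 c.2.

Lemma cellP c i : i < len (ini c) ->
  [/\ ~ s_init (cell c i), s_ksrc (ini c) <-> s_ksrc (cell c i),
      agree (s_src ^~ (ini c)) (s_src ^~ (cell c i)) &
      agree (s_excl ^~ (ini c)) (s_excl ^~ (cell c i))].
Proof.
elim: i => [|i IH] hi.
  by have [h1 h2 h3 h4 _ _] := lenP hi; split.
have [_ k2 k3 k4] := IH (ltnW hi).
have [h1 h2 h3 h4 _ _] := lenP hi.
split=> //; first by rewrite k2.
  exact: agree_trans h3.
exact: agree_trans h4.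
Qed.

Lemma real_king c : real c -> s_ksrc (ini c) -> exists k, c = (Some k, [::]).
Proof.
case: c => b [|i q]; rewrite /ini /real /=.
  by case: b => [k|] //; exists k.
move=> [_ hi hk] hs; have [h _ _ _] := @cellP (b, q) i hi.
by case: (b_king (birthP (iter i.+1 next (ini_path b q)))) => // -[/(_ hs)].
Qed.

Lemma king_real k : real (Some k, [::]) -> kingdom k (ini (Some k, [::])).
Proof. exact: throneP. Qed.

Definition visited (c : person) (i : nat) : person :=
  if pselect (s_ktgt (cell c i)) then (Some (rank U (s_tgt ^~ (cell c i))), [::])
  else (c.1, i :: c.2).

Lemma visited_king c i : s_ktgt (cell c i) ->
  visited c i = (Some (rank U (s_tgt ^~ (cell c i))), [::]).
Proof. by rewrite /visited; case: pselect. Qed.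

Lemma visited_child c i : ~ s_ktgt (cell c i) -> visited c i = (c.1, i :: c.2).
Proof. by rewrite /visited; case: pselect. Qed.

Lemma visited_real c i : real c -> i < len (ini c) -> real (visited c i).
Proof.
move=> hc hi; have [h1 h2 h3 h4] := cellP hi.
case: (pselect (s_ktgt (cell c i))) => hk; last by rewrite visited_child.
rewrite visited_king // /real /=; exists (birth (cell c i)).
have hb := birthP (cell c i); split; first by apply: start_birth; right.
- by case: (b_king hb) => // ->.
- by apply/rankE; case: (b_src hb).
Qed.

Lemma visited_src c i : real c -> i < len (ini c) ->
  agree (s_src ^~ (ini (visited c i))) (s_tgt ^~ (cell c i)).
Proof.
move=> hc hi; have [h1 h2 h3 h4] := cellP hi; have := visited_real hc hi.
case: (pselect (s_ktgt (cell c i))) => hk.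
  by rewrite visited_king // => /king_real[_ _ /rankE].
by rewrite visited_child // => _; case: (b_src (birthP (cell c i))).
Qed.

Lemma visited_excl c i : i < len (ini c) -> s_ktgt (cell c i) ->
  ~ agree (s_excl ^~ (ini c)) (s_tgt ^~ (cell c i)).
Proof.
move=> hi hk hag; have [h1 h2 h3 h4] := cellP hi.
have [P hP] := c_excl HS h1 hk; apply.
by rewrite -(h4 P hP) hag.
Qed.

(** A king excludes its own type, and a child has a longer path than its parent. *)
Lemma visited_neq c i : real c -> i < len (ini c) -> c <> visited c i.
Proof.
move=> hc hi; case: (pselect (s_ktgt (cell c i))) => hk.
  rewrite visited_king // => ec; apply: (visited_excl hi hk).
  have := hc; rewrite {1}ec => /king_real; rewrite -ec => -[[_ hx _] hs /rankE].
  exact: agree_trans (hx hs).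
rewrite visited_child // => /(congr1 (fun c : person => size c.2)) /=; lia.
Qed.

(** Ranks never decrease along a search, and the step right after a king is strict. *)
Lemma rank_visited c i j : real c -> i < j -> j < len (ini c) -> s_ktgt (cell c i) ->
  rank U (s_tgt ^~ (cell c i)) < rank U (s_tgt ^~ (cell c j)).
Proof.
move=> hc hij hj hk.
have step k : k.+1 < len (ini c) ->
    rank U (s_tgt ^~ (cell c k)) + `[< s_ktgt (cell c k) >] <=
    rank U (s_tgt ^~ (cell c k.+1)).
  move=> hk1; have [h1 _ _ _] := cellP (ltnW hk1).
  case: (x_order (lenP hk1)) => // /lex_ltP[h|[/rankE h [hn _]]].
    by apply: leq_trans h; rewrite -addn1 leq_add2l; case: asbool.
  by rewrite -/(cell c k) in hn *; rewrite (asboolF hn) addn0 h.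
have mono k : i.+1 <= k -> k < len (ini c) ->
    rank U (s_tgt ^~ (cell c i.+1)) <= rank U (s_tgt ^~ (cell c k)).
  elim: k => // k IH; rewrite leq_eqVlt => /predU1P[->|hik] hk1 //.
  by apply: leq_trans (IH hik (ltnW hk1)) (leq_trans (leq_addr _ _) (step _ hk1)).
apply: leq_trans (mono _ hij hj).
by have := step i (leq_ltn_trans hij hj); rewrite asboolT // addn1.
Qed.

(** * Visits between persons and the binary relations *)

Definition link (c d : person) (i : nat) : Prop :=
  i < len (ini c) /\ visited c i = d.

(** Children carry the position of their birth in their path; for kings [rank_visited] forbids a
    second visit. *)
Lemma link_inj c d i j : real c -> link c d i -> link c d j -> i = j.
Proof.
have lt_false i' j' : real c -> i' < j' -> link c d i' -> link c d j' -> False.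
  move=> hc hij [hi ei] [hj ej].
  case: (pselect (s_ktgt (cell c i'))) => hki.
    have := rank_visited hc hij hj hki.
    case: (pselect (s_ktgt (cell c j'))) => hkj.
      by move: ei; rewrite -ej !visited_king // => -[->]; rewrite ltnn.
    by move: ei; rewrite -ej visited_king // visited_child.
  case: (pselect (s_ktgt (cell c j'))) => hkj.
    by move: ei; rewrite -ej visited_child // visited_king.
  by move: ei; rewrite -ej !visited_child // => -[e]; rewrite e ltnn in hij.
move=> hc h1 h2; case: (ltngtP i j) => // hij.
  by case: (lt_false _ _ hc hij h1 h2).
by case: (lt_false _ _ hc hij h2 h1).
Qed.

(* A child of a king is not allowed to visit its parent again ([s_excl]), and the
   child of any other element never visits its parent. *)
Lemma child_no_link c d i j : real c -> link c d i -> ~ s_ktgt (cell c i) -> ~ link d c j.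
Proof.
move=> hc [hi ei] hk [hj ej].
case: (pselect (s_ktgt (cell d j))) => hkj; last first.
  move: ej ei; rewrite !visited_child // => ec ed.
  by have := congr1 (fun c : person => size c.2) ec; rewrite -ed /=; lia.
have [h1 h2 h3 h4] := cellP hi.
move: ej; rewrite visited_king // => ec; apply: (visited_excl hj hkj).
have := hc; rewrite -{1}ec => /king_real; rewrite ec => -[_ hs /rankE hr].
have hb := birthP (cell c i).
have -> : ini d = birth (cell c i) by rewrite -ei visited_child.
case: (b_parent hb) => // /(_ (proj1 h2 hs) hk) hex.
exact: agree_trans hex (agree_trans (agree_sym h3) hr).
Qed.

(** By [child_no_link] both visits are to kings, so both persons are named by their types and
    [c_kings] applies. *)
Lemma link_sym c d i j R : real c -> real d -> link c d i -> link d c j -> R \in B ->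
  (s_fwd R (cell c i) <-> s_bwd R (cell d j)) /\ (s_bwd R (cell c i) <-> s_fwd R (cell d j)).
Proof.
move=> hc hd h1 h2 hR.
case: (pselect (s_ktgt (cell c i))) => hk1; last by case: (child_no_link hc h1 hk1 h2).
case: (pselect (s_ktgt (cell d j))) => hk2; last by case: (child_no_link hd h2 hk2 h1).
have [[hi ei] [hj ej]] := (h1, h2).
have [i1 i2 i3 i4] := cellP hi; have [j1 j2 j3 j4] := cellP hj.
move: (ei) (ej); rewrite !visited_king // => ed ec.
have [_ sd /rankE rd] : kingdom (rank U (s_tgt ^~ (cell c i))) (ini d).
  by have := hd; rewrite -{1}ed => /king_real; rewrite ed.
have [_ sc /rankE rc] : kingdom (rank U (s_tgt ^~ (cell d j))) (ini c).
  by have := hc; rewrite -{1}ec => /king_real; rewrite ec.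
apply: (c_kings HS _ _ _ hR).
- by split=> //; split=> //; apply/i2.
- by split=> //; split=> //; apply/j2.
- move=> P hP; rewrite -(i3 P hP) -(j3 P hP); split; first exact: rc.
  exact: iff_sym (rd P hP).
Qed.

(** On unlinked pairs [pickle] decides who comes first, so that [s_rf] and [s_rb] are read at the
    same pair from either side. *)
Definition rel (R : nat) (c d : person) : Prop :=
  [\/ exists2 i, link c d i & s_fwd R (cell c i),
      exists2 i, link d c i & s_bwd R (cell d i) |
      [/\ forall i, ~ link c d i, forall i, ~ link d c i &
          if pickle c < pickle d then s_rf R (ini c) (ini d) else s_rb R (ini d) (ini c)]].

Lemma rel_link c d i R : real c -> real d -> link c d i -> R \in B ->
  (rel R c d <-> s_fwd R (cell c i)) /\ (rel R d c <-> s_bwd R (cell c i)).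
Proof.
move=> hc hd hl hR; split; split.
- move=> [[j hj]|[j hj]|[/(_ i)]] //; first by rewrite (link_inj hc hl hj).
  by move=> hb; apply/(proj1 (link_sym hc hd hl hj hR)).
- by constructor 1; exists i.
- move=> [[j hj]|[j hj]|[_ /(_ i)]] //; last by rewrite (link_inj hc hl hj).
  by move=> hb; apply/(proj2 (link_sym hc hd hl hj hR)).
- by constructor 2; exists i.
Qed.

(** * The unravelled model *)

Definition people : Type := {c : person | real c}.
Definition people_un (P : nat) (c : people) : Prop := s_src P (ini (sval c)).
Definition people_bin (R : nat) (c d : people) : Prop := rel R (sval c) (sval d).

Lemma people_inhabited : inhabited people.
Proof.
case: (pselect (s_ksrc root)) => h; last by constructor; exists (None, [::]).
constructor; exists (Some (rank U (s_src ^~ root)), [::]).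
by exists root; split=> //; apply: start_root.
Qed.

Lemma alpha_link c d i : real c -> real d -> link c d i ->
  qeval (s_src ^~ (ini c)) (s_src ^~ (ini d)) (fun R => rel R c d) (fun R => rel R d c) a /\
  qeval (s_src ^~ (ini d)) (s_src ^~ (ini c)) (fun R => rel R d c) (fun R => rel R c d) a.
Proof.
move=> hc hd hl; have [hi ed] := hl; have [h1 h2 h3 h4] := cellP hi.
have hs := visited_src hc hi; rewrite ed in hs.
case: (c_step HS (cell c i)) => // -[q1 q2].
split; [move: q1|move: q2]; apply: (qeval_ext _ _).1 => [P /aU hP|R /aB hR].
- by split; [exact: iff_sym (h3 P hP)|exact: iff_sym (hs P hP)].
- by have [e1 e2] := rel_link hc hd hl hR; split; apply: iff_sym.
- by split; [exact: iff_sym (hs P hP)|exact: iff_sym (h3 P hP)].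
- by have [e1 e2] := rel_link hc hd hl hR; split; apply: iff_sym.
Qed.

(** The exceptional case of [c_pair] would make [c] and [d] kings of one type, hence the same
    person. *)
Lemma alpha_unlinked c d : real c -> real d -> c <> d ->
  (forall i, ~ link c d i) -> (forall i, ~ link d c i) -> pickle c < pickle d ->
  qeval (s_src ^~ (ini c)) (s_src ^~ (ini d)) (fun R => rel R c d) (fun R => rel R d c) a /\
  qeval (s_src ^~ (ini d)) (s_src ^~ (ini c)) (fun R => rel R d c) (fun R => rel R c d) a.
Proof.
move=> hc hd hcd l1 l2 hlt.
have rcd R : rel R c d <-> s_rf R (ini c) (ini d).
  split=> [[[i /l1]|[i /l2]|[_ _]]|] //; rewrite ?hlt //.
  by move=> h; constructor 3; rewrite hlt.
have rdc R : rel R d c <-> s_rb R (ini c) (ini d).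
  have hgt : (pickle d < pickle c) = false by lia.
  split=> [[[i /l2]|[i /l1]|[_ _]]|] //; rewrite ?hgt //.
  by move=> h; constructor 3; rewrite hgt.
case: (c_pair HS (ini c) (ini d)) => [[hs [/(real_king hc)[k ec] /(real_king hd)[k' ed]]]|[q1 q2]].
  case: hcd; rewrite ec ed; congr (Some _, _).
  have [_ _ <-] : kingdom k (ini c) by move: hc; rewrite ec => /king_real.
  have [_ _ <-] : kingdom k' (ini d) by move: hd; rewrite ed => /king_real.
  exact/rankE.
by split; [move: q1|move: q2]; apply: (qeval_ext _ _).1 => [P _|R _]; split=> //;
   apply: iff_sym.
Qed.

Lemma met_trace c b n : b \in req -> n <= len (ini c) -> s_met b (iter n next (ini c)) ->
  s_met b (ini c) \/
  exists2 i, i < n & if b.2 then s_fwd b.1 (cell c i) else s_bwd b.1 (cell c i).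
Proof.
move=> hb; elim: n => [|n IH] hn; first by left.
have [h1 h2] := x_done (lenP hn) (reqB hb).
rewrite {1}/s_met; case: b hb h1 h2 IH => R [] /= hb h1 h2 IH.
  move=> /h1[/(IH (ltnW hn))[|[i hi hf]]|h]; [by left|right; exists i => //; lia|].
  by right; exists n.
move=> /h2[/(IH (ltnW hn))[|[i hi hf]]|h]; [by left|right; exists i => //; lia|].
by right; exists n.
Qed.

(** The search ends with [b] met. Tracing this back leads to a visited person, or to the birth of a
    child, whose parent is then the witness; kings and the root are born without credit. *)
Lemma people_requirement c b : real c -> b \in req ->
  exists d, [/\ real d, c <> d & lit rel b c d].
Proof.
move=> hc hb; have hR := reqB hb.
have [hm|[i hi hbit]] := met_trace hb (leqnn _) (@len_finished (ini c) b hb).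
  case: c hc hm => k [|i q] hc hm.
    have hst : start (ini (k, [::])).
      by case: k hc hm => [k /king_real[]|_ _] //; apply: start_root.
    have [n1 n2] := st_done hst hR.
    by move: hm; rewrite /s_met; case: (b.2).
  have [hp hi hk] : [/\ real (k, q), i < len (ini (k, q)) & ~ s_ktgt (cell (k, q) i)] := hc.
  have hl : link (k, q) (k, i :: q) i.
    by split; rewrite ?visited_child.
  exists (k, q); have [e1 e2] := rel_link hp hc hl hR; split=> //.
    by move=> /(congr1 (fun c : person => size c.2)) /=; lia.
  have hbs := birthP (cell (k, q) i).
  move: hm; rewrite /s_met /lit; case: (b.2).
    by move=> /(b_dfwd hbs hR)[_ [_ h]]; apply/e2.
  by move=> /(b_dbwd hbs hR)[_ [_ h]]; apply/e1.
have hl : link c (visited c i) i by [].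
have hd := visited_real hc hi; exists (visited c i); split=> //; first exact: visited_neq.
have [e1 e2] := rel_link hc hd hl hR.
by move: hbit; rewrite /lit; case: (b.2) => h; [apply/e1|apply/e2].
Qed.

Lemma people_normal_model : normal_model g a req people_un people_bin.
Proof.
split=> [c|[c hc] [d hd] hcd|b hb [c hc]].
- exact: (c_gamma HS).
- have {}hcd : c <> d by move=> e; apply: hcd; apply: eq_exist.
  rewrite /people_un /people_bin /=.
  case: (pselect (exists i, link c d i)) => [[i hl]|l1].
    by case: (alpha_link hc hd hl).
  case: (pselect (exists i, link d c i)) => [[i hl]|l2].
    by case: (alpha_link hd hc hl).
  have {}l1 i : ~ link c d i by move=> h; apply: l1; exists i.
  have {}l2 i : ~ link d c i by move=> h; apply: l2; exists i.
  case: (ltngtP (pickle c) (pickle d)) => h.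
  + by case: (alpha_unlinked hc hd hcd l1 l2 h).
  + by case: (alpha_unlinked hd hc (nesym hcd) l2 l1 h).
  + by case: hcd; apply: (pcan_inj pickleK).
- have [d [hd hcd hl]] := people_requirement hc hb.
  exists (exist _ d hd); last by [].
  by move=> /(congr1 sval).
Qed.

End Unravel.

(** * Equisatisfiability and conclusion *)

Lemma satisfiable_reduction f : in_normal_form f -> satisfiable f <-> satisfiable (reduction f).
Proof.
move=> [g [a [s [e /and4P[qg eg dg ng] /and3P[qa ea da] hs _]]]].
set b := bigand [seq FAll vx (FEx vy (FAnd b neq_xy)) | b <- s] in e *.
have eatoms : atoms f = atoms g ++ atoms a ++ atoms b by rewrite e.
have -> : reduction f = reduced g a (atoms f) (atoms b) by rewrite {1}e eatoms.
have aU : {subset unary_occ a <= unary_occ f}.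
  by move=> P hP; rewrite e /= !mem_cat hP ?orbT.
have aB : {subset binary_occ a <= binary_occ f}.
  by move=> R hR; rewrite e /= !mem_cat hR ?orbT.
have reqB : {in requirements (atoms b), forall c, c.1 \in binary_occ f}.
  move=> c /mapP[[[i P] v]]; rewrite mem_filter => /andP[/= hi hx] ->.
  have := allP (atoms_over f) (i, P, v).
  by rewrite eatoms !mem_cat hx !orbT hi; apply.
have norm M : models M f <->
    normal_model g a (requirements (atoms b)) (@unary_interp M) (@binary_interp M).
  by rewrite e; apply: models_normal_form.
have red N := models_reduced N (atoms f) (atoms b) qg eg dg ng qa ea.
rewrite un_of_atoms bin_of_atoms in red.
split=> [[M hM]|[N /red hN]].
  move/norm: hM => hM.
  have hin : inhabited (pt (model_search (unary_occ f) (requirements (atoms b))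
      (@unary_interp M) (@binary_interp M))).
    by have [x] := dom_nonempty M; constructor; exists (Node x x None (fun _ _ => false));
      apply: sound_start hM _.
  exists (structure_of hin); apply/red; rewrite structure_ofK.
  exact: model_search_correct.
have [x0] := dom_nonempty N.
exists (Structure (people_inhabited hN x0) (@people_un _ _ _ _ _ _ hN x0)
  (@people_bin _ _ _ _ _ _ hN x0)).
by apply/norm; apply: people_normal_model.
Qed.

Theorem mainTheorem6 :
  exists F : fo2 -> fo2,
    linear_time_on in_normal_form F /\
    (forall Psi : fo2, in_normal_form Psi ->
       [/\ sentence (F Psi), equality_free (F Psi), diagonal_free (F Psi)
         & satisfiable Psi <-> satisfiable (F Psi)]) /\
    (exists C : nat, forall Psi : fo2, in_normal_form Psi ->
       num_predicates (F Psi) <= C * (num_unary Psi + num_binary Psi)).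
Proof.
exists reduction; split; first exact: reduction_linear_time.
split; last by exists 12; apply: num_predicates_reduction.
move=> f hf; have := over_reduction hf; rewrite overP => /and4P[he hd _ _].
by split=> //; [apply: sentence_reduction | apply: satisfiable_reduction].
Qed.
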